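(* Let $\mathcal{Q}_o$ be the Grassmannian of oriented linear $n$-planes of $\mathbb{R}^m$, and let $R$ be the curvature tensor of the tautological bundles, i.e. of $\tau_T\oplus\tau_N\to\mathcal{Q}_o$ with the direct sum connection $\nabla^T\oplus\nabla^N$. Then, for all $p_o\in\mathcal{Q}_o$, $u,v\in T_{p_o}\mathcal{Q}_o$ and $\xi\in(\tau_T)_{p_o}\oplus(\tau_N)_{p_o}$, $$R(u,v)\xi=\epsilon_n\,[\xi,[u,v]],\qquad \epsilon_n=(-1)^{\frac{n(n+1)}{2}+1}.$$ Equivalently, $R(u,v)=\epsilon_n\,[u,v]\in\Lambda^2p_o\oplus\Lambda^2p_o^\perp$, where an element $\eta$ of $\Lambda^2p_o\oplus\Lambda^2p_o^\perp$ is regarded as the skew-symmetric operator $\xi\mapsto[\xi,\eta]$ on $p_o\oplus p_o^\perp$.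
   Context: $\mathcal{Q}_o\subset\Lambda^n\mathbb{R}^m$: an oriented plane with positive orthonormal basis $(e_1,\dots,e_n)$ is represented by $e_1\wedge\dots\wedge e_n$. The tangent space $T_{p_o}\mathcal{Q}_o\subset\Lambda^n\mathbb{R}^m$ is identified with $L(p_o,p_o^\perp)$: the linear map $u$ corresponds to $\sum_{i=1}^n e_1\wedge\dots\wedge u(e_i)\wedge\dots\wedge e_n$ ($u(e_i)$ in $i$-th position). The tautological bundles are $\tau_T=\{(p_o,v): v\in p_o\}$ and $\tau_N=\{(p_o,v): v\in p_o^\perp\}$ over $\mathcal{Q}_o$, with the natural connections $\nabla^T_u\xi=(d\xi(u))^T$ and $\nabla^N_u\xi=(d\xi(u))^N$ (orthogonal projections on $p_o$, resp. $p_o^\perp$, of the derivative in $\mathbb{R}^m$). The curvature convention is $R(u,v)\xi=\nabla_u\nabla_v\xi-\nabla_v\nabla_u\xi-\nabla_{[u,v]_{\mathrm{Lie}}}\xi$ for vector fields $u,v$, with $[u,v]_{\mathrm{Lie}}$ their Lie bracket. The Clifford algebra $Cl(\mathbb{R}^m)$ is taken with the convention $e_i\cdot e_i=-1$ for unit vectors, and $\Lambda^*\mathbb{R}^m$ is identified with $Cl(\mathbb{R}^m)$ as a vector space in the usual way ($e_{i_1}\wedge\dots\wedge e_{i_j}\leftrightarrow e_{i_1}\cdot\ldots\cdot e_{i_j}$ for an orthonormal basis and distinct indices). Thus the fibres of $T\mathcal{Q}_o$, $\tau_T$, $\tau_N$ are regarded as subsets of $Cl(\mathbb{R}^m)$.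 The bracket on $Cl(\mathbb{R}^m)$ (denoted $[\cdot,\cdot]$ in the claim) is $[\eta,\eta']=\frac12(\eta\cdot\eta'-\eta'\cdot\eta)$. *)

(* Defs.v *)
From HB Require Import structures.
From mathcomp Require Import all_boot all_order all_algebra.
From mathcomp Require Import all_classical all_reals all_analysis.

Set Implicit Arguments.
Unset Strict Implicit.
Unset Printing Implicit Defensive.

Import Order.TTheory GRing.Theory Num.Theory.
Import numFieldNormedType.Exports.

Local Open Scope classical_set_scope.
Local Open Scope ring_scope.

(* The common underlying vector space of Lambda^* R^m and Cl(R^m), given by
   coordinates on the blades e_I = e_{i_1} ^ ... ^ e_{i_j} = e_{i_1} ... e_{i_j},
   I = {i_1 < ... < i_j}, of the canonical basis.  The identification of
   Lambda^* R^m with Cl(R^m) is thus the identity; only the products differ. *)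
Definition cliff (R : realType) (m : nat) := 'rV[R]_#|{set 'I_m}|.

Definition coef (R : realType) (m : nat) (a : cliff R m) (I : {set 'I_m}) : R :=
  a 0 (enum_rank I).

Definition blade (R : realType) (m : nat) (I : {set 'I_m}) : cliff R m :=
  delta_mx 0 (enum_rank I).

(* Number of transpositions that sort the concatenation of I and J. *)
Definition inversions (m : nat) (I J : {set 'I_m}) : nat :=
  #|[set ij : 'I_m * 'I_m | [&& ij.1 \in I, ij.2 \in J & (ij.2 < ij.1)%N]]|.

(* e_I . e_J: after sorting, each index of I :&: J contributes e_i . e_i = -1. *)
Definition cmul (R : realType) (m : nat) (a b : cliff R m) : cliff R m :=
  \sum_(I : {set 'I_m}) \sum_(J : {set 'I_m})
    (coef a I * coef b J * (-1) ^+ (inversions I J + #|I :&: J|)) *: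
      blade R ((I :\: J) :|: (J :\: I)).

Definition wedge (R : realType) (m : nat) (a b : cliff R m) : cliff R m :=
  \sum_(I : {set 'I_m}) \sum_(J : {set 'I_m} | [disjoint I & J])
    (coef a I * coef b J * (-1) ^+ inversions I J) *: blade R (I :|: J).

Definition bracket (R : realType) (m : nat) (a b : cliff R m) : cliff R m :=
  2^-1 *: (cmul a b - cmul b a).

Definition vec (R : realType) (m : nat) (x : 'rV[R]_m) : cliff R m :=
  \sum_(i < m) x 0 i *: blade R [set i].

Definition wedge_rows (R : realType) (m n : nat) (e : 'M[R]_(n, m)) : cliff R m :=
  \big[@wedge R m/blade R finset.set0]_(i < n) vec (row i e).

Definition dot (R : realType) (k : nat) (x y : 'rV[R]_k) : R :=
  \sum_(i < k) x 0 i * y 0 i.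

(* The rows of e form a positive orthonormal basis of the plane p. *)
Definition pos_frame (R : realType) (m n : nat) (p : cliff R m)
    (e : 'M[R]_(n, m)) : Prop :=
  e *m e^T = 1%:M /\ p = wedge_rows e.

(* An oriented n-plane is the unit n-vector e_1 ^ ... ^ e_n, so that the
   Grassmannian is a submanifold of Lambda^n R^m, itself inside cliff R m. *)
Definition grass (R : realType) (m n : nat) : set (cliff R m) :=
  [set p | exists e : 'M[R]_(n, m), pos_frame p e].

Definition plane (R : realType) (m n : nat) (p : cliff R m) : set 'rV[R]_m :=
  [set x | exists2 e : 'M[R]_(n, m), pos_frame p e & (x <= e)%MS].

Definition orth (R : realType) (m : nat) (A : set 'rV[R]_m) : set 'rV[R]_m :=
  [set x | forall y, A y -> dot x y = 0].

Definition orth_proj (R : realType) (m : nat) (A : set 'rV[R]_m)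
    (x : 'rV[R]_m) : 'rV[R]_m :=
  get [set y | A y /\ forall z, A z -> dot (x - y) z = 0].

(* sum_i e_1 ^ ... ^ u(e_i) ^ ... ^ e_n, for the linear map u : x |-> x *m A. *)
Definition tangent_of (R : realType) (m n : nat) (e : 'M[R]_(n, m))
    (A : 'M[R]_m) : cliff R m :=
  \sum_(i < n) wedge_rows
    (\matrix_(k < n) (if k == i then row k e *m A else row k e)).

(* T_p Q_o, as the image of L(p, p^perp); u is the restriction to p of the
   endomorphism x |-> x *m A of R^m. *)
Definition tangent (R : realType) (m n : nat) (p : cliff R m) : set (cliff R m) :=
  [set w | exists (e : 'M[R]_(n, m)) (A : 'M[R]_m),
     [/\ pos_frame p e,
         forall x, plane n p x -> orth (plane n p) (x *m A)
       & w = tangent_of e A]].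

Fixpoint Ck (R : realType) (V W : normedModType R) (k : nat) (O : set V)
    (f : V -> W) : Prop :=
  match k with
  | 0 => forall x, O x -> {for x, continuous f}
  | k'.+1 => (forall x, O x -> differentiable f x) /\
             forall v, Ck k' O (fun x => 'D_v f x)
  end.

(* F is a smooth extension of f|Q to an open neighbourhood of p. *)
Definition local_extension (R : realType) (V W : normedModType R) (Q : set V)
    (f : V -> W) (p : V) (F : V -> W) : Prop :=
  exists O : set V,
    [/\ open O, O p, forall k, Ck k O F & forall q, O q -> Q q -> F q = f q].

Definition smooth_on (R : realType) (V W : normedModType R) (Q : set V)
    (f : V -> W) : Prop :=
  forall p, Q p -> exists F, local_extension Q f p F.

(* Differential at p of the map f|Q.  When f is smooth on the submanifold Q and
   u is tangent to Q at p, the value does not depend on the extension. *)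
Definition dalong (R : realType) (V W : normedModType R) (Q : set V)
    (f : V -> W) (p u : V) : W :=
  get [set w | exists2 F, local_extension Q f p F & w = 'D_u F p].

(* Fibre at p of tau_T (+) tau_N. *)
Definition taut_fibre (R : realType) (m n : nat) (p : cliff R m) :
    set ('rV[R]_m * 'rV[R]_m) :=
  [set xi | plane n p xi.1 /\ orth (plane n p) xi.2].

(* The fibre p (+) p^perp inside Cl(R^m). *)
Definition taut_vec (R : realType) (m : nat) (xi : 'rV[R]_m * 'rV[R]_m) :
    cliff R m :=
  vec (xi.1 + xi.2).

(* Vector fields and sections are represented by total functions of which only
   the values on the Grassmannian matter. *)
Definition vector_field (R : realType) (m n : nat) (X : cliff R m -> cliff R m) :
    Prop :=
  smooth_on (@grass R m n) X /\ forall p, grass n p -> tangent n p (X p).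

Definition taut_section (R : realType) (m n : nat)
    (s : cliff R m -> 'rV[R]_m * 'rV[R]_m) : Prop :=
  smooth_on (@grass R m n) s /\ forall p, grass n p -> taut_fibre n p (s p).

Definition nablaT (R : realType) (m n : nat) (X : cliff R m -> cliff R m)
    (s : cliff R m -> 'rV[R]_m) (p : cliff R m) : 'rV[R]_m :=
  orth_proj (plane n p) (dalong (@grass R m n) s p (X p)).

Definition nablaN (R : realType) (m n : nat) (X : cliff R m -> cliff R m)
    (s : cliff R m -> 'rV[R]_m) (p : cliff R m) : 'rV[R]_m :=
  orth_proj (orth (plane n p)) (dalong (@grass R m n) s p (X p)).

Definition nabla (R : realType) (m n : nat) (X : cliff R m -> cliff R m)
    (s : cliff R m -> 'rV[R]_m * 'rV[R]_m) (p : cliff R m) :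
    'rV[R]_m * 'rV[R]_m :=
  (nablaT n X (fun q => (s q).1) p, nablaN n X (fun q => (s q).2) p).

(* Lie bracket of tangent fields of a submanifold of a vector space:
   dY(X) - dX(Y). *)
Definition lie_bracket (R : realType) (m n : nat)
    (X Y : cliff R m -> cliff R m) (p : cliff R m) : cliff R m :=
  dalong (@grass R m n) Y p (X p) - dalong (@grass R m n) X p (Y p).

Definition curvature_op (R : realType) (m n : nat)
    (X Y : cliff R m -> cliff R m) (s : cliff R m -> 'rV[R]_m * 'rV[R]_m)
    (p : cliff R m) : 'rV[R]_m * 'rV[R]_m :=
  nabla n X (nabla n Y s) p - nabla n Y (nabla n X s) p
  - nabla n (lie_bracket n X Y) s p.

Definition extend_at (R : realType) (m n : nat) (p u v : cliff R m)
    (xi : 'rV[R]_m * 'rV[R]_m) (X Y : cliff R m -> cliff R m)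
    (s : cliff R m -> 'rV[R]_m * 'rV[R]_m) : Prop :=
  [/\ vector_field n X, vector_field n Y & taut_section n s] /\
  [/\ X p = u, Y p = v & s p = xi].

(* r is the common value at p of the curvature over all extensions of
   u, v and xi, of which there is at least one. *)
Definition is_curvature (R : realType) (m n : nat) (p u v : cliff R m)
    (xi r : 'rV[R]_m * 'rV[R]_m) : Prop :=
  (exists X Y s, extend_at n p u v xi X Y s) /\
  (forall X Y s, extend_at n p u v xi X Y s -> curvature_op n X Y s p = r).

Definition curvature (R : realType) (m n : nat) (p u v : cliff R m)
    (xi : 'rV[R]_m * 'rV[R]_m) : 'rV[R]_m * 'rV[R]_m :=
  get [set r | is_curvature n p u v xi r].

Definition Lambda2 (R : realType) (m : nat) (A : set 'rV[R]_m) : set (cliff R m) :=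
  [set eta | exists (k : nat) (x y : 'I_k -> 'rV[R]_m),
     (forall i, A (x i) /\ A (y i)) /\
     eta = \sum_(i < k) wedge (vec (x i)) (vec (y i))].

Definition taut_bivector (R : realType) (m n : nat) (p : cliff R m) :
    set (cliff R m) :=
  [set eta | exists eta1 eta2,
     [/\ Lambda2 (plane n p) eta1, Lambda2 (orth (plane n p)) eta2
       & eta = eta1 + eta2]].

(* The operator xi |-> [xi, eta]; note the order of the arguments. *)
Definition bivector_op (R : realType) (m : nat) (eta xi : cliff R m) : cliff R m :=
  bracket xi eta.

Definition skew_operator (R : realType) (m n : nat) (p : cliff R m)
    (f : cliff R m -> cliff R m) : Prop :=
  (forall xi, taut_fibre n p xi ->
     exists2 zeta, taut_fibre n p zeta & f (taut_vec xi) = taut_vec zeta) /\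
  (forall xi zeta, taut_fibre n p xi -> taut_fibre n p zeta ->
     dot (f (taut_vec xi)) (taut_vec zeta) =
     - dot (taut_vec xi) (f (taut_vec zeta))).

Definition eps_sign (R : realType) (n : nat) : R :=
  (-1) ^+ ((n * n.+1)./2 + 1).

(* Main.v *)
Require Import Defs.
From HB Require Import structures.
From mathcomp Require Import all_boot all_order all_algebra.
From mathcomp Require Import all_classical all_reals all_analysis.
From mathcomp Require Import ring lra zify.

(** Idea.  In the Clifford algebra the plane with positive orthonormal basis
    e_1, ..., e_n is the product p = e_1 ... e_n.  Its square is the scalar
    (-1)^(n(n+1)/2), and x |-> p x p is, up to sign, the orthogonal reflection
    in the plane, so the projections on the plane and on its complement are
    quadratic polynomials in p.  A tangent vector at p is u = U p with U in
    p ^ p_perp; such a U anticommutes with p, whence [u, v] = epsilon_n [U, V].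
    For either projection Pi the derivative of x |-> Pi x along u is, up to
    sign, the commutator with U composed with the reflection.  By symmetry of
    second derivatives the curvature is Pi (d_u Pi d_v Pi - d_v Pi d_u Pi), and
    the Jacobi identity turns this into [xi, [U, V]].

    Derivatives along tangent vectors do not depend on the chosen extension:
    the tangent space is spanned by vectors v for which the great circle
    cos t p + sin t v stays in the Grassmannian. *)
Set Implicit Arguments.
Unset Strict Implicit.
Unset Printing Implicit Defensive.

Import Order.TTheory GRing.Theory Num.Theory.
Import numFieldNormedType.Exports.
Local Open Scope ring_scope.

(** * The Clifford algebra *)

(** The definitions speak of arbitrary frames and of unspecified local extensions; the proof
    replaces both by equations in the algebra. The product q x q makes sense for every q, so [proj]
    extends the projections off the Grassmannian, and the covariant derivative of a section again
    has an explicit smooth extension, ready for a second derivative. Tangent vectors w at p become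
    the solutions of linear equations that are bilinear and symmetric in p and w; differentiating
    these along two fields and subtracting shows that Lie brackets are tangent. Both bundles are
    treated at once by a sign c, equal to [plane_sign] for the plane and to its opposite for the
    complement. In the curvature the second derivatives of the section cancel, and Pi dPi Pi = 0
    removes the remaining first derivatives. Since [curvature] is chosen by [get] among values
    common to all extensions, extensions must also be exhibited: the linear fields q |-> [U, q], and
    constant vectors projected on the fibres. *)

Local Notation symdiff I J := ((I :\: J) :|: (J :\: I))%SET.

Section Clifford.
Variables (R : realType) (m : nat).
Implicit Types (a b c : cliff R m) (I J K : {set 'I_m}) (x y : 'rV[R]_m).

Definition blade_sign I J : R := (-1) ^+ (inversions I J + #|I :&: J|).

(** Inversions count the pairs with j < i and the intersection those with j = i, together j <= i. In
    this form the sign is multiplicative in each set for symmetric difference, since the square of a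
    sign is 1. *)
Lemma blade_signE I J :
  blade_sign I J = \prod_(i in I) \prod_(j in J) (-1) ^+ (j <= i)%N.
Proof.
rewrite /blade_sign /inversions -!sum1_card.
rewrite [RHS](_ : _ = \prod_(i in I) (-1) ^+ (\sum_(j in J) (j <= i)%N)); last first.
  by apply: eq_bigr => i _; rewrite prodrXr.
rewrite prodrXr; congr (_ ^+ _); rewrite pair_big_dep /=.
transitivity (\sum_(p | (p.1 \in I) && (p.2 \in J)) ((p.2 < p.1) + (p.2 == p.1 :> nat)))%N; last first.
  by apply: eq_bigr => -[i j] /= _; case: ltngtP.
rewrite big_split /=; congr addn.
  rewrite big_mkcond [RHS]big_mkcond; apply: eq_bigr => p _.
  rewrite [p \in _]/in_mem /= /in_set asboolb; case: (p.1 \in I); case: (p.2 \in J) => //=; by case: ltnP.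
rewrite [RHS](bigID (fun p : 'I_m * 'I_m => p.2 == p.1)) /= [X in (_ + X)%N]big1 ?addn0; last first.
  by move=> [i j] /= /andP[_ /negbTE]; rewrite -val_eqE /= => ->.
rewrite (reindex_onto (fun i => (i, i)) (fun p => p.1)) /=.
  apply: eq_big => [i|i _]; last by rewrite eqxx.
  by rewrite !eqxx !andbT inE.
by move=> [i j] /= /andP[_ /eqP ->].
Qed.

Lemma prod_symdiff (f : 'I_m -> R) I J : (forall i, f i * f i = 1) ->
  \prod_(i in symdiff I J) f i = \prod_(i in I) f i * \prod_(i in J) f i.
Proof.
move=> ff; rewrite [LHS]big_mkcond [X in X * _]big_mkcond [X in _ * X]big_mkcond -big_split /=.
apply: eq_bigr => i _; rewrite !inE.
by case: (i \in I); case: (i \in J); rewrite /= ?mulr1 ?mul1r.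
Qed.

Lemma blade_sign_symdiffl I J K :
  blade_sign (symdiff I J) K = blade_sign I K * blade_sign J K.
Proof.
rewrite !blade_signE prod_symdiff // => i; rewrite -big_split big1 //= => j _.
by rewrite -expr2 sqrr_sign.
Qed.

Lemma blade_sign_symdiffr I J K :
  blade_sign I (symdiff J K) = blade_sign I J * blade_sign I K.
Proof.
rewrite !blade_signE -big_split; apply: eq_bigr => i _.
by rewrite prod_symdiff // => j; rewrite -expr2 sqrr_sign.
Qed.

Lemma coefD a b I : coef (a + b) I = coef a I + coef b I.
Proof. by rewrite /coef mxE. Qed.
Lemma coefZ (k : R) a I : coef (k *: a) I = k * coef a I.
Proof. by rewrite /coef mxE. Qed.
Lemma coef_blade I J : coef (@blade R m I) J = (J == I)%:R.
Proof. by rewrite /coef /blade mxE eqxx (inj_eq enum_rank_inj). Qed.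

Lemma blade_sum a : a = \sum_I coef a I *: blade R I.
Proof.
rewrite {1}[a]row_sum_delta (reindex (@enum_rank {set 'I_m})) //.
exact: (onW_bij _ (enum_rank_bij _)).
Qed.

Lemma cmul_linear a : linear (cmul a).
Proof.
move=> k b c; rewrite /cmul scaler_sumr -big_split /=; apply: eq_bigr => I _.
rewrite scaler_sumr -big_split /=; apply: eq_bigr => J _.
by rewrite scalerA -scalerDl coefD coefZ mulrDr mulrDl mulrCA !mulrA.
Qed.

Lemma cmul_linearl b : linear (fun a => cmul a b).
Proof.
move=> k a c; rewrite /cmul scaler_sumr -big_split /=; apply: eq_bigr => I _.
rewrite scaler_sumr -big_split /=; apply: eq_bigr => J _.
by rewrite scalerA -scalerDl coefD coefZ !mulrDl !mulrA.
Qed.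

HB.instance Definition _ a := GRing.isLinear.Build R _ _ *:%R (cmul a) (cmul_linear a).
Definition cmulr b a := cmul a b.
HB.instance Definition _ b := GRing.isLinear.Build R _ _ *:%R (cmulr b) (cmul_linearl b).

Lemma cmul_blade I J :
  cmul (blade R I) (blade R J) = blade_sign I J *: blade R (symdiff I J).
Proof.
rewrite /cmul (bigD1 I) //= [X in _ + X]big1 ?addr0; last first.
  move=> K /negbTE nKI; rewrite big1 // => L _.
  by rewrite coef_blade nKI !mul0r scale0r.
rewrite (bigD1 J) //= [X in _ + X]big1 ?addr0; last first.
  by move=> K /negbTE nKI; rewrite !coef_blade nKI mulr0 mul0r scale0r.
by rewrite !coef_blade !eqxx !mul1r.
Qed.

Lemma linear_blade_ext (V : lmodType R) (f g : {linear cliff R m -> V}) :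
  (forall I, f (blade R I) = g (blade R I)) -> f =1 g.
Proof.
move=> fg a; rewrite [a]blade_sum !linear_sum.
by apply: eq_bigr => I _; rewrite !linearZ fg.
Qed.

(** Trilinearity reduces this to blades, where bimultiplicativity of the sign yields the same three
    factors on both sides. *)
Lemma cmulA : associative (@cmul R m).
Proof.
move=> a b c; move: a.
apply: (@linear_blade_ext _ (cmulr (cmul b c)) (cmulr c \o cmulr b)) => I /=.
rewrite /cmulr; move: b.
apply: (@linear_blade_ext _ (cmul (blade R I) \o cmulr c) (cmulr c \o cmul (blade R I))) => J /=.
rewrite /cmulr; move: c.
apply: (@linear_blade_ext _ (cmul (blade R I) \o cmul (blade R J)) (cmul (cmul (blade R I) (blade R J)))) => K /=.
rewrite !cmul_blade linearZ -[cmul (_ *: _) _]/(cmulr _ _) linearZ /= /cmulr !cmul_blade.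
rewrite !scalerA blade_sign_symdiffl blade_sign_symdiffr.
congr (_ *: blade _ _); first by rewrite mulrC mulrA.
apply/setP => i; rewrite !inE.
by case: (i \in I); case: (i \in J); case: (i \in K).
Qed.

Lemma blade_sign0l J : blade_sign finset.set0 J = 1.
Proof. by rewrite blade_signE finset.big_set0. Qed.
Lemma blade_sign0r J : blade_sign J finset.set0 = 1.
Proof. by rewrite blade_signE big1 // => i _; rewrite finset.big_set0. Qed.

Lemma cmul1l : left_id (blade R finset.set0) (@cmul R m).
Proof.
apply: (@linear_blade_ext _ (cmul (blade R finset.set0)) idfun) => I /=.
by rewrite cmul_blade blade_sign0l scale1r finset.set0D finset.setD0 finset.set0U.
Qed.

Lemma cmul1r : right_id (blade R finset.set0) (@cmul R m).
Proof.
apply: (@linear_blade_ext _ (cmulr (blade R finset.set0)) idfun) => I /=.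
by rewrite /cmulr cmul_blade blade_sign0r scale1r finset.set0D finset.setD0 finset.setU0.
Qed.

Lemma cmulDl : left_distributive (@cmul R m) +%R.
Proof. by move=> a b c; exact: (linearD (cmulr c)). Qed.
Lemma cmulDr : right_distributive (@cmul R m) +%R.
Proof. by move=> a b c; exact: (linearD (cmul a)). Qed.

Lemma cmulZl (k : R) a b : cmul (k *: a) b = k *: cmul a b.
Proof. by rewrite -[LHS]/(cmulr b (k *: a)) linearZ. Qed.
Lemma cmulZr (k : R) a b : cmul a (k *: b) = k *: cmul a b.
Proof. by rewrite linearZ. Qed.

Lemma blade0_neq0 : blade R finset.set0 != 0 :> cliff R m.
Proof.
apply/eqP => /(congr1 (fun a => coef a finset.set0)) /eqP.
by rewrite coef_blade eqxx /coef mxE oner_eq0.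
Qed.

HB.instance Definition _ := GRing.Lmodule.copy (cliff R m) 'rV[R]_#|{set 'I_m}|.
HB.instance Definition _ := GRing.Zmodule_isNzRing.Build (cliff R m)
  cmulA cmul1l cmul1r cmulDl cmulDr blade0_neq0.

Fact cliff_scalerAl (k : R) (a b : cliff R m) : k *: (a * b) = (k *: a) * b.
Proof. exact/esym/cmulZl. Qed.
HB.instance Definition _ := GRing.Lmodule_isLalgebra.Build R (cliff R m) cliff_scalerAl.
Fact cliff_scalerAr (k : R) (a b : cliff R m) : k *: (a * b) = a * (k *: b).
Proof. exact/esym/cmulZr. Qed.
HB.instance Definition _ := GRing.Lalgebra_isAlgebra.Build R (cliff R m) cliff_scalerAr.

Lemma coefN a I : coef (- a) I = - coef a I.
Proof. by rewrite /coef mxE. Qed.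

Lemma cliffP a b : (forall I, coef a I = coef b I) -> a = b.
Proof. by move=> ab; apply/rowP => i; rewrite -(enum_valK i); exact: ab. Qed.
End Clifford.

(* Identities between noncommutative monomials are linear, hence checked on coordinates. *)
Ltac cliff_linear := apply: cliffP => ?; rewrite !(coefD, coefN, coefZ); ring.
Ltac cliff_field := apply: cliffP => ?; rewrite !(coefD, coefN, coefZ); by field.

(** * Vectors in the Clifford algebra, grade involution and exterior product *)

Section Vectors.
Variables (R : realType) (m : nat).
Implicit Types (a b c : cliff R m) (I J K : {set 'I_m}) (x y z : 'rV[R]_m).

Lemma vec_is_linear : linear (@vec R m).
Proof.
move=> k x y; rewrite /vec scaler_sumr -big_split /=; apply: eq_bigr => i _.
by rewrite !mxE scalerA -scalerDl.
Qed.
HB.instance Definition _ :=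
  GRing.isLinear.Build R 'rV[R]_m (cliff R m) *:%R (@vec R m) vec_is_linear.

Definition unvec a : 'rV[R]_m := \row_i coef a [set i]%SET.
Lemma unvec_is_linear : linear unvec.
Proof. by move=> k a b; apply/rowP => i; rewrite !mxE coefD coefZ. Qed.
HB.instance Definition _ :=
  GRing.isLinear.Build R (cliff R m) 'rV[R]_m *:%R unvec unvec_is_linear.

Lemma vecK : cancel (@vec R m) unvec.
Proof.
move=> x; apply/rowP => i; rewrite mxE /vec /coef summxE (bigD1 i) //= big1 ?addr0.
  by rewrite mxE -/(coef _ _) coef_blade eqxx mulr1.
move=> j ji; rewrite mxE -/(coef _ _) coef_blade (inj_eq finset.set1_inj) eq_sym.
by rewrite (negbTE ji) mulr0.
Qed.

Lemma symdiff11 (i : 'I_m) : symdiff [set i] [set i] = finset.set0.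
Proof. by rewrite finset.setDv finset.setU0. Qed.

Lemma symdiffC I J : symdiff I J = symdiff J I.
Proof. by rewrite finset.setUC. Qed.

(** For j distinct from i exactly one of i <= j and j <= i holds, so each such j changes the sign; j
    = i contributes -1 to both orders. *)
Lemma blade_sign_swap (i : 'I_m) J :
  blade_sign R J [set i] = (-1) ^+ (#|J| + (i \in J)) * blade_sign R [set i] J.
Proof.
rewrite !blade_signE finset.big_set1.
under eq_bigr do rewrite finset.big_set1.
rewrite -sum1_card exprD -prodrXr.
have -> : (-1) ^+ (i \in J) = \prod_(j in J) (-1) ^+ (j == i) :> R.
  case: (boolP (i \in J)) => iJ.
    rewrite (bigD1 i) //= eqxx big1 ?mulr1 // => j /andP[_ /negbTE ->] //.
  by rewrite big1 // => j jJ; case: eqP => // ji; rewrite -ji jJ in iJ.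
rewrite -!big_split /=; apply: eq_bigr => j _.
by rewrite -val_eqE /= -!exprD -signr_odd -[RHS]signr_odd; case: ltngtP.
Qed.

Lemma cliffZl (k : R) a b : (k *: a) * b = k *: (a * b).
Proof. by rewrite scalerAl. Qed.
Lemma cliffZr (k : R) a b : a * (k *: b) = k *: (a * b).
Proof. by rewrite scalerAr. Qed.

Lemma vec_anticomm x y :
  vec x * vec y + vec y * vec x = (- (2 * dot x y)) *: 1 :> cliff R m.
Proof.
have e2 (i j : 'I_m) : blade R [set i]%SET * blade R [set j]%SET +
    blade R [set j]%SET * blade R [set i]%SET
      = (- (2 * (i == j)%:R)) *: 1 :> cliff R m.
  rewrite ![_ * _ in LHS]cmul_blade (symdiffC [set j]) -scalerDl.
  rewrite (blade_sign_swap i [set j]%SET) finset.cards1 finset.in_set1.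
  case: eqP => [<-|ij]; rewrite ?symdiff11 ?finset.setDv ?finset.setU0.
    congr (_ *: _); rewrite blade_signE !finset.big_set1 leqnn /=; ring.
  rewrite !mulr0 oppr0 !scale0r /= addn0 expr1 mulN1r subrr scale0r //.
have vecM u v : vec u * vec v = \sum_i \sum_j (u 0 i * v 0 j) *:
    (blade R [set i]%SET * blade R [set j]%SET) :> cliff R m.
  rewrite /vec mulr_suml; apply: eq_bigr => i _; rewrite mulr_sumr.
  by apply: eq_bigr => j _; rewrite -scalerAl -scalerAr scalerA.
rewrite (vecM x) (vecM y) [X in _ + X]exchange_big -big_split /=.
rewrite /dot mulr_sumr -sumrN scaler_suml; apply: eq_bigr => i _.
rewrite -big_split (bigD1 i) //= [X in _ + X]big1 ?addr0 => [|j ji].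
  by rewrite [y 0 i * _]mulrC -scalerDr e2 eqxx mulr1 scalerA; congr (_ *: _); ring.
by rewrite [y 0 j * _]mulrC -scalerDr e2 eq_sym (negbTE ji) mulr0 oppr0 scale0r scaler0.
Qed.

Lemma vec_comm x y :
  vec x * vec y = - (vec y * vec x) + (- (2 * dot x y)) *: 1 :> cliff R m.
Proof. by rewrite -vec_anticomm addrC addrK. Qed.

Lemma vec_sq x : vec x * vec x = - dot x x *: 1 :> cliff R m.
Proof.
have -> : vec x * vec x = 2^-1 *: (vec x * vec x + vec x * vec x) :> cliff R m.
  by cliff_field.
by rewrite vec_anticomm scalerA; congr (_ *: _); field.
Qed.

Lemma bracketE a b : bracket a b = 2^-1 *: (a * b - b * a).
Proof. by []. Qed.

(** Carrying x through both factors leaves only two scalar corrections, so the commutator is again a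
    vector: degree-two elements act on R^m as infinitesimal rotations. *)
Lemma bracket_vec_mul x y z :
  bracket (vec x) (vec y * vec z) = vec (dot x z *: y - dot x y *: z).
Proof.
rewrite bracketE mulrA vec_comm mulrDl mulNr -[vec y * vec x * _]mulrA.
rewrite (vec_comm x z) mulrDr mulrN -!mulrA -!scalerAl mul1r -!scalerAr mulr1.
rewrite (linearB (@vec R m)) !(linearZZ (@vec R m)).
cliff_field.
Qed.

Lemma jacobi a b c :
  bracket a (bracket b c) = bracket (bracket a b) c - bracket (bracket a c) b.
Proof.
rewrite !bracketE !(cliffZl, cliffZr, mulrBl, mulrBr, mulrA).
cliff_field.
Qed.

(** The grade involution, which is -1 on vectors and multiplicative. *)
Definition hat a : cliff R m := \sum_(J : {set 'I_m}) ((-1) ^+ #|J| * coef a J) *: blade R J.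
Lemma hat_is_linear : linear hat.
Proof.
move=> k a b; rewrite /hat scaler_sumr -big_split /=; apply: eq_bigr => I _.
by rewrite coefD coefZ mulrDr scalerDl scalerA mulrCA.
Qed.
HB.instance Definition _ :=
  GRing.isLinear.Build R (cliff R m) (cliff R m) *:%R hat hat_is_linear.

Lemma hat_blade I : hat (blade R I) = (-1) ^+ #|I| *: blade R I.
Proof.
rewrite /hat (bigD1 I) //= big1 ?addr0 ?coef_blade ?eqxx ?mulr1 // => J /negbTE JI.
by rewrite coef_blade JI mulr0 scale0r.
Qed.

Lemma hat_vec_mul y a : hat (vec y * a) = - (vec y * hat a).
Proof.
rewrite [in LHS]/vec [in RHS]/vec !mulr_suml linear_sum -sumrN; apply: eq_bigr => i _.
rewrite -!scalerAl linearZ -scalerN; congr (_ *: _); move: a.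
apply: (@linear_blade_ext _ _ _ (hat \o cmul (blade R [set i]%SET))
   (-%R \o cmul (blade R [set i]%SET) \o hat)) => J /=.
rewrite cmul_blade !hat_blade cmulZr cmul_blade linearZ /= hat_blade !scalerA -scaleNr.
congr (_ *: _); rewrite -prodr_const prod_symdiff ?finset.big_set1 ?prodr_const; last first.
  by move=> _; rewrite mulrNN mulr1.
ring.
Qed.

Lemma wedge_linear a : linear (wedge a).
Proof.
move=> k b c; rewrite /wedge scaler_sumr -big_split /=; apply: eq_bigr => I _.
rewrite scaler_sumr -big_split /=; apply: eq_bigr => J _.
by rewrite scalerA -scalerDl coefD coefZ mulrDr mulrDl mulrCA !mulrA.
Qed.
HB.instance Definition _ a :=
  GRing.isLinear.Build R (cliff R m) (cliff R m) *:%R (wedge a) (wedge_linear a).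

Lemma wedge_linearl b : linear (fun a => wedge a b).
Proof.
move=> k a c; rewrite /wedge scaler_sumr -big_split /=; apply: eq_bigr => I _.
rewrite scaler_sumr -big_split /=; apply: eq_bigr => J _.
by rewrite scalerA -scalerDl coefD coefZ !mulrDl !mulrA.
Qed.
Definition wedger b a := wedge a b.
HB.instance Definition _ b :=
  GRing.isLinear.Build R (cliff R m) (cliff R m) *:%R (wedger b) (wedge_linearl b).

Lemma wedge_blade I J : wedge (blade R I) (blade R J) =
  if [disjoint I & J] then (-1) ^+ inversions I J *: blade R (I :|: J)%SET else 0.
Proof.
rewrite /wedge (bigD1 I) //= [X in _ + X]big1 ?addr0; last first.
  move=> K /negbTE nKI; rewrite big1 // => L _.
  by rewrite coef_blade nKI !mul0r scale0r.
rewrite big_mkcond (bigD1 J) //= [X in _ + X]big1 ?addr0; last first.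
  move=> K /negbTE nKI; case: ifP => // _.
  by rewrite !coef_blade nKI mulr0 mul0r scale0r.
by rewrite !coef_blade !eqxx !mul1r.
Qed.

(** On e_i and e_J the two Clifford products agree when i is outside J and cancel when i is in J, by
    [blade_sign_swap]. *)
Lemma wedge_vec x a : wedge (vec x) a = 2^-1 *: (vec x * a + hat a * vec x).
Proof.
rewrite -[LHS]/(wedger a _) [in LHS]/vec [in RHS]/vec linear_sum mulr_suml mulr_sumr.
rewrite -big_split scaler_sumr; apply: eq_bigr => i _ /=.
rewrite -scalerAl -scalerAr -scalerDr linearZ scalerA mulrC -scalerA; congr (_ *: _).
move: a; pose b := blade R [set i]%SET.
have lin : linear (fun a => 2^-1 *: (b * a + hat a * b)).
  move=> k a c; rewrite linearP mulrDl mulrDr -scalerAl -scalerAr !scalerDr !scalerA.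
  cliff_linear.
pose F := GRing.isLinear.Build R (cliff R m) (cliff R m) *:%R _ lin.
pose G : {linear _ -> _} := HB.pack (fun a => 2^-1 *: (b * a + hat a * b)) F.
apply: (@linear_blade_ext _ _ _ (wedge b) G) => J /=.
rewrite hat_blade -scalerAl /b ![_ * _ in RHS]cmul_blade wedge_blade (symdiffC J) scalerA.
rewrite (blade_sign_swap i J) mulrA -exprD addnA exprD -mulrA.
rewrite -scalerDl scalerA addnn -muln2 exprM sqrr_sign mul1r.
have -> : [disjoint [set i]%SET & J] = (i \notin J) by rewrite disjoints1.
case: (boolP (i \in J)) => iJ /=.
  by rewrite expr1 mulN1r subrr mulr0 scale0r.
have -> (t : R) : 2^-1 * (t + (-1) ^+ 0 * t) = t by rewrite expr0; field.
have d : ([set i] :&: J)%SET = finset.set0.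
  by apply/eqP; rewrite finset.setI_eq0 disjoints1.
rewrite /blade_sign d finset.cards0 addn0; congr (_ *: blade _ _).
by apply/setP => j; rewrite !finset.inE; case: eqP => [->|_]; rewrite ?iJ //; case: (j \in J).
Qed.

Lemma wedge_vec_vec x y : wedge (vec x) (vec y) = bracket (vec x) (vec y).
Proof.
rewrite wedge_vec bracketE; congr (_ *: (_ + _)).
have := hat_vec_mul y 1; rewrite mulr1 => ->.
by rewrite -[1]/(blade R finset.set0) hat_blade finset.cards0 scale1r mulr1 mulNr.
Qed.

End Vectors.

(** * Products of orthogonal vectors and the Grassmannian *)

Section OrthogonalProducts.
Variables (R : realType) (m : nat) (I : eqType).
Implicit Types (f : I -> 'rV[R]_m) (x : 'rV[R]_m) (r : seq I).
Local Notation P f r := (\prod_(i <- r) vec (f i) : cliff R m).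

Lemma vec_anticommutes x (y : 'rV[R]_m) : dot x y = 0 ->
  vec x * vec y = - (vec y * vec x) :> cliff R m.
Proof. by move=> xy; rewrite vec_comm xy mulr0 oppr0 scale0r addr0. Qed.

Lemma vec_prod_anticomm f x r : (forall i, i \in r -> dot x (f i) = 0) ->
  vec x * P f r = (-1) ^+ size r *: (P f r * vec x).
Proof.
elim: r => [|i r IH] xf; first by rewrite !big_nil mulr1 mul1r scale1r.
have {}IH := IH (fun j jr => xf j (mem_behead (s := i :: r) jr)).
rewrite !big_cons /= mulrA vec_anticommutes ?xf ?mem_head //.
by rewrite mulNr -[_ * _ * P f r]mulrA IH exprS mulN1r scaleNr cliffZr mulrA.
Qed.

(** All factors except [f i] itself anticommute with [vec (f i)]: one sign fewer than in
    [vec_prod_anticomm], which has the parity of one sign more. *)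
Lemma vec_prod_comm f i r : (forall j k, j != k -> dot (f j) (f k) = 0) ->
  uniq r -> i \in r -> vec (f i) * P f r = (-1) ^+ (size r).+1 *: (P f r * vec (f i)).
Proof.
move=> ff; elim: r => // j r IH /= /andP[jr ur]; rewrite in_cons !big_cons.
case: (eqVneq i j) => [-> _|ij /= ir].
  rewrite -[_ * P f r * _]mulrA (@vec_prod_anticomm _ (f j) r) => [|k kr].
    by rewrite !cliffZr !exprS !mulN1r opprK.
  by apply: ff; apply: contraNneq jr => ->.
rewrite mulrA vec_anticommutes ?ff // mulNr -[_ * _ * P f r]mulrA IH //.
by rewrite [(-1) ^+ _.+2]exprS mulN1r scaleNr cliffZr mulrA.
Qed.

(** The pair x (f i) commutes with every factor orthogonal to both, so it can be moved next to
    [f i], where (f i)(f i) = -1 leaves x. *)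
Lemma prod_replace f i x r :
  (forall j k, j != k -> dot (f j) (f k) = 0) -> dot (f i) (f i) = 1 ->
  (forall j, j != i -> dot x (f j) = 0) -> uniq r -> i \in r ->
  P (fun j => if j == i then x else f j) r = - (vec x * vec (f i) * P f r).
Proof.
move=> ff fi xf; elim: r => // j r IH /= /andP[jr ur]; rewrite in_cons !big_cons.
case: (eqVneq i j) => [ij _|ij /= ir]; last first.
  have jx : vec (f j) * (vec x * vec (f i)) = vec x * vec (f i) * vec (f j) :> cliff R m.
    rewrite mulrA vec_anticommutes; last first.
      by rewrite -(xf j) 1?eq_sym // /dot; apply: eq_bigr => k _; rewrite mulrC.
    rewrite mulNr -[in LHS]mulrA (@vec_anticommutes (f j)) ?mulrN ?opprK; last by rewrite ff // eq_sym.
    by rewrite mulrA.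
  by rewrite IH // mulrN [in LHS]mulrA jx [in RHS]mulrA.
rewrite -ij [_ * (_ * P f r)]mulrA -[_ * _ * vec (f i)]mulrA vec_sq fi.
rewrite scaleN1r mulrN mulr1 mulNr opprK; congr (_ * _).
rewrite [LHS]big_seq_cond [RHS]big_seq_cond; apply: eq_bigr => k /andP[kr _].
by case: eqP => // ki; rewrite -ij -ki kr in jr.
Qed.

Lemma wedge_prod f r : (forall j k, j != k -> dot (f j) (f k) = 0) -> uniq r ->
  \big[@wedge R m/blade R finset.set0]_(i <- r) vec (f i) = P f r.
Proof.
move=> ff; have hatP s : hat (P f s) = (-1) ^+ size s *: P f s.
  elim: s => [|i s IH]; first by rewrite !big_nil hat_blade finset.cards0.
  by rewrite !big_cons hat_vec_mul IH cliffZr exprS mulN1r scaleNr.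
elim: r => [|i r IH /= /andP[ir ur]]; first by rewrite !big_nil.
rewrite !big_cons IH // wedge_vec hatP cliffZl -vec_prod_anticomm => [|j jr].
  by cliff_field.
by apply: ff; apply: contraNneq ir => ->.
Qed.

(** In the square of e_1 ... e_n, reordering costs n(n-1)/2 transpositions and the n squares give -1
    each: n(n+1)/2 signs in all. *)
Definition square_sign (n : nat) : R := (-1) ^+ (n * n.+1)./2.

Lemma square_sign_sq n : square_sign n * square_sign n = 1.
Proof. by rewrite -expr2 sqrr_sign. Qed.

Lemma square_signS n : square_sign n.+1 = (-1) ^+ n.+1 * square_sign n.
Proof.
rewrite /square_sign -exprD; congr (_ ^+ _).
rewrite (_ : (n.+1 * n.+2 = n.+1 * 2 + n * n.+1)%N); last by lia.
by rewrite halfD !muln2 odd_double doubleK.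
Qed.

Lemma prod_sq f r : (forall j k, dot (f j) (f k) = (j == k)%:R) -> uniq r ->
  P f r * P f r = square_sign (size r) *: 1.
Proof.
move=> ff; elim: r => [|i r IH /= /andP[ir ur]].
  by rewrite !big_nil mulr1 /square_sign expr0 scale1r.
rewrite !big_cons -!mulrA [P f r * (_ * _)]mulrA.
have -> : P f r * vec (f i) = (-1) ^+ size r *: (vec (f i) * P f r).
  rewrite vec_prod_anticomm ?scalerA -?expr2 ?sqrr_sign ?scale1r // => j jr.
  by rewrite ff; case: eqP ir => // ->; rewrite jr.
rewrite cliffZl cliffZr -mulrA IH // mulrA vec_sq ff eqxx.
by rewrite -scalerAl mul1r !scalerA square_signS exprS; congr (_ *: _); rewrite /=; ring.
Qed.

End OrthogonalProducts.

Section Dot.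
Variables (R : realType) (m : nat).
Implicit Types x y z : 'rV[R]_m.

Lemma dotE x y : dot x y = (x *m y^T) 0 0.
Proof. by rewrite mxE; apply: eq_bigr => i _; rewrite mxE. Qed.
Lemma dotC x y : dot x y = dot y x.
Proof. by apply: eq_bigr => i _; rewrite mulrC. Qed.
Lemma dotDl x y z : dot (x + y) z = dot x z + dot y z.
Proof. by rewrite !dotE mulmxDl mxE. Qed.
Lemma dotBl x y z : dot (x - y) z = dot x z - dot y z.
Proof. by rewrite !dotE mulmxBl !mxE. Qed.
Lemma dotZl k x z : dot (k *: x) z = k * dot x z.
Proof. by rewrite !dotE -scalemxAl mxE. Qed.
Lemma dotDr x y z : dot x (y + z) = dot x y + dot x z.
Proof. by rewrite !(dotC x) dotDl. Qed.
Lemma dotZr k x z : dot x (k *: z) = k * dot x z.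
Proof. by rewrite !(dotC x) dotZl. Qed.

Lemma dot_eq0 x : (dot x x == 0) = (x == 0).
Proof.
apply/eqP/eqP => [|->]; last by rewrite /dot big1 // => i _; rewrite mxE mul0r.
move/psumr_eq0P => h; apply/rowP => i; rewrite mxE.
by apply/eqP; rewrite -[_ == 0]orbb -mulf_eq0 h // => j _; rewrite -expr2 sqr_ge0.
Qed.
End Dot.

(** * Reflections and orthogonal projections as sandwich products *)

Section Reflections.
Variables (R : realType) (m : nat).
Implicit Types (p q : cliff R m) (x y z : 'rV[R]_m) (k : R).

(** For q in the Grassmannian the sandwich is already a vector and [unvec] loses nothing; for other
    q, [unvec] keeps the map R^m-valued and quadratic in q. *)
Definition rho q x : 'rV[R]_m := unvec (q * vec x * q).
Definition proj k q x := 2^-1 *: (x + k *: rho q x).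

Lemma rho_is_linear q : linear (rho q).
Proof. by move=> k x y; rewrite /rho linearP mulrDr mulrDl cliffZr cliffZl linearP. Qed.
HB.instance Definition _ q :=
  GRing.isLinear.Build R 'rV[R]_m 'rV[R]_m *:%R (rho q) (rho_is_linear q).

Lemma proj_is_linear k q : linear (proj k q).
Proof.
move=> c x y; rewrite /proj linearP; apply/rowP => i; rewrite !mxE; ring.
Qed.
HB.instance Definition _ k q :=
  GRing.isLinear.Build R 'rV[R]_m 'rV[R]_m *:%R (proj k q) (proj_is_linear k q).

End Reflections.

Section Frames.
Variables (R : realType) (m n : nat) (p : cliff R m) (e : 'M[R]_(n, m)).
Hypothesis pe : pos_frame p e.
Implicit Types x y z : 'rV[R]_m.

Lemma frame_dot i j : dot (row i e) (row j e) = (i == j)%:R.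
Proof.
by case: pe => ee _; rewrite dotE tr_row -row_mul mulmx_colsub mxE mxE -/(e *m _) ee mxE.
Qed.

Lemma frame_orth i j : i != j -> dot (row i e) (row j e) = 0.
Proof. by move=> /negbTE ij; rewrite frame_dot ij. Qed.

Lemma frame_prod : p = \prod_(i < n) vec (row i e).
Proof.
case: pe => _ ->; rewrite /wedge_rows wedge_prod ?index_enum_uniq //.
exact: frame_orth.
Qed.

Lemma size_index_enum_ord : size (index_enum 'I_n) = n.
Proof. by rewrite -[RHS]size_enum_ord enumT. Qed.

Lemma frame_sq : p * p = square_sign R n *: 1.
Proof.
rewrite frame_prod prod_sq ?index_enum_uniq ?size_index_enum_ord //.
exact: frame_dot.
Qed.

Lemma dot_row x i : dot x (row i e) = (x *m e^T) 0 i.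
Proof. by rewrite /dot mxE; apply: eq_bigr => j _; rewrite !mxE. Qed.

Lemma frame_anticomm x : x *m e^T = 0 -> vec x * p = (-1) ^+ n *: (p * vec x).
Proof.
move=> xe; rewrite frame_prod vec_prod_anticomm ?size_index_enum_ord // => i _.
by rewrite dot_row xe mxE.
Qed.

Lemma frame_comm x : (x <= e)%MS -> vec x * p = (-1) ^+ n.+1 *: (p * vec x).
Proof.
move=> /submxP[c ->]; rewrite mulmx_sum_row linear_sum mulr_suml mulr_sumr scaler_sumr.
apply: eq_bigr => i _; rewrite (linearZZ (@vec R m)) cliffZl cliffZr scalerA mulrC -scalerA.
congr (_ *: _); rewrite frame_prod (@vec_prod_comm _ _ _ (fun i => row i e)).
- by rewrite size_index_enum_ord.
- exact: frame_orth.
- exact: index_enum_uniq.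
- exact: mem_index_enum.
Qed.

Definition frame_part x := x *m e^T *m e.

Lemma frame_part_sub x : (frame_part x <= e)%MS.
Proof. exact: submxMl. Qed.

Lemma frame_part_orth x : (x - frame_part x) *m e^T = 0.
Proof. by case: pe => ee _; rewrite mulmxBl -!mulmxA ee mulmx1 subrr. Qed.

Lemma frame_part_id x : (x <= e)%MS -> frame_part x = x.
Proof. by case: pe => ee _ /submxP[c ->]; rewrite /frame_part -(mulmxA c) ee mulmx1. Qed.

(** Split x into its plane and normal parts: they commute with p up to opposite signs, and the
    remaining p p is a scalar. *)
Lemma frame_sandwich x : p * vec x * p =
  vec ((- ((-1) ^+ n.+1 * square_sign R n)) *: (x - 2 *: frame_part x)).
Proof.
have {1}-> : x = frame_part x + (x - frame_part x) by rewrite addrC subrK.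
rewrite linearD mulrDr mulrDl -!mulrA.
rewrite (frame_comm (frame_part_sub x)) (frame_anticomm (frame_part_orth x)).
rewrite !cliffZr !mulrA frame_sq -!scalerAl !mul1r.
rewrite (linearZZ (@vec R m)) !(linearB (@vec R m)) (linearZZ (@vec R m)).
rewrite exprS mulN1r; cliff_linear.
Qed.

Lemma frame_rho x :
  rho p x = (- ((-1) ^+ n.+1 * square_sign R n)) *: (x - 2 *: frame_part x).
Proof. by rewrite /rho frame_sandwich vecK. Qed.

End Frames.

Section Planes.
Variables (R : realType) (m n : nat).
Implicit Types (p q : cliff R m) (x y z : 'rV[R]_m) (k : R) (e : 'M[R]_(n, m)).

(** The eigenvalue of [rho p] on the plane; on the complement it is the opposite. *)
Definition plane_sign : R := (-1) ^+ n.+1 * square_sign R n.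

Lemma plane_sign_sq : plane_sign * plane_sign = 1.
Proof. by rewrite /plane_sign mulrACA square_sign_sq mulr1 -expr2 sqrr_sign. Qed.

Lemma frame_proj p e x : pos_frame p e -> proj plane_sign p x = frame_part e x.
Proof.
move=> pe; rewrite /proj (frame_rho pe) -/plane_sign scalerA mulrN plane_sign_sq.
by apply/rowP => i; rewrite !mxE; field.
Qed.

Lemma projN k q x : proj (- k) q x = x - proj k q x.
Proof. by apply/rowP => i; rewrite !mxE; field. Qed.

Lemma grass_sq p : grass n p -> p * p = square_sign R n *: 1.
Proof. by move=> [e /frame_sq]. Qed.

Lemma vec_rho p x : grass n p -> vec (rho p x) = p * vec x * p.
Proof. by move=> [e pe]; rewrite /rho (frame_sandwich pe) vecK. Qed.

Lemma rhoK p : grass n p -> involutive (rho p).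
Proof.
move=> gp x; rewrite {1}/rho (vec_rho _ gp) -!mulrA grass_sq // !mulrA grass_sq //.
by rewrite -!(scalerAl, scalerAr) mul1r mulr1 scalerA square_sign_sq scale1r vecK.
Qed.

Lemma proj_idem k p x : k * k = 1 -> grass n p -> proj k p (proj k p x) = proj k p x.
Proof.
move=> kk gp; rewrite /proj (linearZZ (rho p) 2^-1) (linearD (rho p)) (linearZZ (rho p) k) /= (rhoK gp).
apply/rowP => i; rewrite !mxE.
transitivity (2^-1 * (2^-1 * (1 + k * k) * x 0 i + k * coef (p * vec x * p) [set i]%SET)).
  by field.
rewrite kk; by field.
Qed.

(** The right side involves p only, so the plane does not depend on which positive frame witnesses
    membership. *)
Lemma plane_proj p x : grass n p -> plane n p x <-> proj plane_sign p x = x.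
Proof.
move=> [e pe]; split => [[e' pe' xe']|<-].
  by rewrite (frame_proj _ pe') (frame_part_id pe').
by exists e => //; rewrite (frame_proj _ pe) frame_part_sub.
Qed.

Lemma orth_plane_frame p e x : pos_frame p e ->
  orth (plane n p) x <-> x *m e^T = 0.
Proof.
move=> pe; have gp : grass n p by exists e.
split => [xp|xe y [e' pe' ye']].
  apply/rowP => i; rewrite -dot_row mxE; apply: xp.
  by exists e => //; exact: row_sub.
have : plane n p y by exists e'.
move/(plane_proj _ gp); rewrite (frame_proj _ pe) => <-.
by rewrite dotE /frame_part trmx_mul mulmxA xe mul0mx mxE.
Qed.

Lemma orth_plane_proj p x : grass n p ->
  orth (plane n p) x <-> proj (- plane_sign) p x = x.
Proof.
move=> [e pe]; rewrite (orth_plane_frame _ pe) projN (frame_proj _ pe).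
split => [xe|<-]; last exact: (frame_part_orth pe).
by rewrite /frame_part xe mul0mx subr0.
Qed.

(** This evaluates the [get] in [orth_proj]: two candidates differ by an element of A that is
    orthogonal to itself. *)
Lemma orth_proj_unique (A : set 'rV[R]_m) x y :
  (forall z t, A z -> A t -> A (z - t)) -> A y ->
  (forall z, A z -> dot (x - y) z = 0) -> orth_proj A x = y.
Proof.
move=> AB Ay xy; rewrite /orth_proj; set S := (X in get X).
have [Ag xg] : S (get S) by apply: (@getI _ _ y).
apply/eqP; rewrite -subr_eq0 -dot_eq0; apply/eqP.
have := xy _ (AB _ _ Ag Ay); have := xg _ (AB _ _ Ag Ay).
set g := get S; move=> h1 h2.
have -> : dot (g - y) (g - y) = dot (x - y) (g - y) - dot (x - g) (g - y).
  by rewrite -dotBl; congr dot; apply/rowP => i; rewrite !mxE; ring.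
by rewrite h1 h2 subrr.
Qed.

Lemma orth_proj_plane p x : grass n p -> orth_proj (plane n p) x = proj plane_sign p x.
Proof.
move=> gp; apply: orth_proj_unique => [z t||z].
- by rewrite !plane_proj // linearB /= => -> ->.
- apply/(plane_proj _ gp); exact: proj_idem (plane_sign_sq) gp.
move=> Pz; case: (gp) => e pe; rewrite -projN.
by apply: ((orth_plane_frame _ pe).2 _) => //; rewrite projN (frame_proj _ pe) (frame_part_orth pe).
Qed.

Lemma orth_proj_orth p x : grass n p ->
  orth_proj (orth (plane n p)) x = proj (- plane_sign) p x.
Proof.
move=> gp; apply: orth_proj_unique => [z t||z].
- by rewrite !orth_plane_proj // linearB /= => -> ->.
- apply/(orth_plane_proj _ gp); apply: proj_idem gp; rewrite mulrNN; exact: plane_sign_sq.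
move=> Nz; rewrite projN opprB addrC subrK dotC; apply: Nz.
apply/(plane_proj _ gp); exact: proj_idem (plane_sign_sq) gp.
Qed.

End Planes.

(** * Tangent spaces *)

Section Bracket.
Variables (R : realType) (m : nat).
Implicit Types a b c : cliff R m.

Lemma bracket_linear a : linear (bracket a).
Proof.
move=> k b c; rewrite !bracketE mulrDr mulrDl cliffZr cliffZl.
cliff_linear.
Qed.
HB.instance Definition _ a :=
  GRing.isLinear.Build R (cliff R m) (cliff R m) *:%R (bracket a) (bracket_linear a).

Lemma bracketC a b : bracket a b = - bracket b a.
Proof. by rewrite !bracketE -scalerN opprB. Qed.

Lemma bracket_linearl b : linear (fun a => bracket a b).
Proof. by move=> k a c; rewrite !(bracketC _ b) linearP opprD scalerN. Qed.
Definition bracketr b a := bracket a b.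
HB.instance Definition _ b :=
  GRing.isLinear.Build R (cliff R m) (cliff R m) *:%R (bracketr b) (bracket_linearl b).

Lemma bracketDl a b c : bracket (a + b) c = bracket a c + bracket b c.
Proof. exact: (linearD (bracketr c)). Qed.
End Bracket.

Section Mixed.
Variables (R : realType) (m n : nat).
Implicit Types (p q U w : cliff R m) (x y z : 'rV[R]_m) (k : R) (e : 'M[R]_(n, m)) (A : 'M[R]_m).

Definition is_vec w := vec (unvec w) = w.

Lemma is_vec_vec x : is_vec (vec x).
Proof. by rewrite /is_vec vecK. Qed.

Lemma is_vecZ k w : is_vec w -> is_vec (k *: w).
Proof. by rewrite /is_vec !linearZ /= => ->. Qed.

(* The bivectors in p ^ p_perp, characterized by their commutators; dividing a
   tangent vector of the Grassmannian by p yields such a bivector. *)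
Definition mixed_bivector p U :=
  p * U = - (U * p) /\ forall x, is_vec (bracket (vec x) U).

(* The linearization at p of the equations q q = const, q x q \in R^m. *)
Definition tangent_eqs p w :=
  p * w + w * p = 0 /\ forall x, is_vec (w * vec x * p + p * vec x * w).

(** The quotient of w by p on the right, the inverse of p being p up to [square_sign]. *)
Definition generator w p := square_sign R n *: (w * p).

Lemma generatorK p w : grass n p -> generator w p * p = w.
Proof.
move=> gp; rewrite /generator cliffZl -mulrA (grass_sq gp) cliffZr mulr1 scalerA.
by rewrite square_sign_sq scale1r.
Qed.

(** The left side is the derivative of q |-> q x q at p along U p. Anticommutation moves the second
    U to the far right, which leaves a commutator with p x p. *)
Lemma bracket_rho p U x : grass n p -> p * U = - (U * p) ->
  U * p * vec x * p + p * vec x * (U * p) = -2 *: bracket (vec (rho p x)) U.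
Proof.
move=> gp pU; rewrite (vec_rho _ gp) bracketE.
have -> : p * vec x * (U * p) = - (p * vec x * p * U).
  by rewrite (_ : U * p = - (p * U)) ?mulrN ?mulrA // pU opprK.
rewrite -!mulrA; cliff_field.
Qed.

Lemma mixed_bivector_mul p U :
  grass n p -> mixed_bivector p U -> tangent_eqs p (U * p).
Proof.
move=> gp [pU Uv]; split => [|x]; first by rewrite mulrA pU mulNr addNr.
by rewrite (bracket_rho _ gp) //; apply: is_vecZ.
Qed.

Lemma generator_mixed p w :
  grass n p -> tangent_eqs p w -> mixed_bivector p (generator w p).
Proof.
move=> gp [pw wv].
have pU : p * generator w p = - (generator w p * p).
  rewrite /generator cliffZr cliffZl -scalerN mulrA; congr (_ *: _).
  by apply/eqP; rewrite -addr_eq0 -mulrDl pw mul0r.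
(* As [rho p] is an involution, testing the hypothesis on [rho p x] reaches the commutator with x
   itself. *)
split=> // x; have := wv (rho p x); rewrite -{1 2}(generatorK w gp).
rewrite (bracket_rho _ gp) // (rhoK gp) => h.
have -> : bracket (vec x) (generator w p) =
    - 2^-1 *: (-2 *: bracket (vec x) (generator w p)) by cliff_field.
exact: is_vecZ h.
Qed.

(** The action of U on R^m, with the argument order of [bivector_op]. *)
Definition adj U x := unvec (bracket (vec x) U).

Lemma adj_is_linear U : linear (adj U).
Proof.
move=> k x y; rewrite /adj linearP -[bracket _ U]/(bracketr U _) linearP /= linearP //.
Qed.
HB.instance Definition _ U :=
  GRing.isLinear.Build R 'rV[R]_m 'rV[R]_m *:%R (adj U) (adj_is_linear U).

Lemma vec_adj p U x : mixed_bivector p U -> vec (adj U x) = bracket (vec x) U.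
Proof. by move=> [_]; exact. Qed.

(** Conjugating by p changes the sign of U. Hence [adj U] anticommutes with the reflection and
    exchanges the plane with its complement. *)
Lemma rho_adj p U x : grass n p -> mixed_bivector p U ->
  rho p (adj U x) = - adj U (rho p x).
Proof.
move=> gp mU; have [pU _] := mU; rewrite /rho (vec_adj _ mU) /adj.
rewrite -linearN; congr unvec; rewrite -/(rho p x) (vec_rho _ gp) !bracketE.
have Up : U * p = - (p * U) by rewrite pU opprK.
rewrite cliffZr cliffZl mulrBr mulrBl -scalerN opprB addrC; congr (_ *: (_ + _)).
  by rewrite !mulrA pU !mulNr opprK.
by rewrite -!mulrA Up !mulrN.
Qed.

Lemma adj_skew p U x y : mixed_bivector p U -> dot (adj U x) y = - dot x (adj U y).
Proof.
move=> mU; apply/eqP; rewrite -addr_eq0; apply/eqP.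
have h : (- (2 * dot (adj U x) y)) *: 1 + (- (2 * dot x (adj U y))) *: 1 = 0 :> cliff R m.
  rewrite -!vec_anticomm !(vec_adj _ mU) !bracketE !cliffZl !cliffZr !mulrBl !mulrBr.
  (* The commutator with U is a derivation; applied to the Clifford relation it kills the scalar
     side. *)
  have := vec_anticomm x y => /(congr1 (fun a => U * a - a * U)).
  rewrite cliffZl cliffZr mul1r mulr1 subrr mulrDr mulrDl !mulrA => h.
  rewrite -[RHS](scaler0 _ (- 2^-1)) -h; cliff_field.
have := congr1 (fun a => coef a finset.set0) h.
rewrite coefD !coefZ (_ : coef 1 _ = 1) ?mulr1; last by rewrite coef_blade eqxx.
rewrite [coef 0 _]mxE => h'.
rewrite (_ : _ + _ = - 2^-1 * (- (2 * dot (adj U x) y) + - (2 * dot x (adj U y)))).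
  by rewrite h' mulr0.
by field.
Qed.

(** Left multiplication of p by e_i (A e_i) replaces the factor e_i by A e_i when A e_i is normal to
    the plane; the sum therefore generates [tangent_of e A]. *)
Definition frame_bivector e A : cliff R m :=
  \sum_i vec (row i e) * vec (row i e *m A).

Lemma bracket_frame_bivector e A x : bracket (vec x) (frame_bivector e A) =
  vec (x *m (A^T *m e^T *m e - e^T *m e *m A)).
Proof.
rewrite /frame_bivector linear_sum /= mulmxBr !mulmxA.
rewrite (mulmx_sum_row (x *m A^T *m e^T)) -(mulmxA _ e A) (mulmx_sum_row (x *m e^T)).
rewrite -sumrB linear_sum; apply: eq_bigr => i _.
rewrite bracket_vec_mul -!dot_row row_mul; congr (vec (_ *: _ - _)).
by rewrite !dotE trmx_mul mulmxA.
Qed.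

End Mixed.

Section TangentFrames.
Variables (R : realType) (m n : nat) (p : cliff R m) (e : 'M[R]_(n, m)).
Hypothesis pe : pos_frame p e.
Implicit Types (U w : cliff R m) (A : 'M[R]_m) (x : 'rV[R]_m).

Let gp : grass n p. Proof. by exists e. Qed.

Lemma frame_bivector_anticomm A : e *m A *m e^T = 0 ->
  p * frame_bivector e A = - (frame_bivector e A * p).
Proof.
move=> eA; rewrite /frame_bivector mulr_sumr mulr_suml -sumrN; apply: eq_bigr => i _.
rewrite -[X in _ = - X]mulrA (frame_anticomm pe); last first.
  by rewrite -!row_mul eA row0.
rewrite cliffZr !mulrA (frame_comm pe) ?row_sub // cliffZl scalerA exprS mulN1r mulrN.
by rewrite -expr2 sqrr_sign scaleN1r opprK.
Qed.

Lemma frame_bivector_mixed A : e *m A *m e^T = 0 -> mixed_bivector p (frame_bivector e A).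
Proof.
move=> eA; split=> [|x]; first exact: frame_bivector_anticomm.
by rewrite bracket_frame_bivector; exact: is_vec_vec.
Qed.

(** A component of x along row i is allowed: besides normal vectors, the lemma serves rotated rows
    cos t e_i + sin t y. *)
Lemma wedge_rows_replace i x : (forall j, j != i -> dot x (row j e) = 0) ->
  wedge_rows (\matrix_(k < n) (if k == i then x else row k e)) =
  - (vec x * vec (row i e) * p).
Proof.
move=> xe; rewrite (frame_prod pe).
rewrite -(@prod_replace _ _ _ (fun k => row k e) i x (index_enum 'I_n)) ?index_enum_uniq ?mem_index_enum //.
- rewrite /wedge_rows wedge_prod ?index_enum_uniq //.
    by apply: eq_bigr => k _; rewrite rowK.
  move=> j k jk; rewrite !rowK; case: eqP => [ji|/eqP ji]; case: eqP => [ki|/eqP ki].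
  - by rewrite ji ki eqxx in jk.
  - exact: xe.
  - by rewrite dotC; exact: xe.
  - exact: (frame_orth pe).
- exact: (frame_orth pe).
- by rewrite (frame_dot pe) eqxx.
Qed.

Lemma tangent_of_frame A : e *m A *m e^T = 0 ->
  tangent_of e A = frame_bivector e A * p.
Proof.
move=> eA; rewrite /tangent_of /frame_bivector mulr_suml; apply: eq_bigr => i _.
have eAi j : dot (row i e *m A) (row j e) = 0.
  by rewrite dot_row -!row_mul eA !mxE.
transitivity (wedge_rows (\matrix_(k < n) (if k == i then row i e *m A else row k e))).
  by congr wedge_rows; apply/matrixP => k j; rewrite !mxE; case: eqP => // ->.
rewrite wedge_rows_replace // (@vec_anticommutes _ _ _ (row i e)) ?mulNr ?opprK //.
Qed.

(** The action [adj U] is skew and exchanges plane and complement, so some frame bivector acts in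
    the same way. The difference Z commutes with all vectors, hence with p, but also anticommutes
    with p; thus Z p = 0 and Z = 0. *)
Lemma mixed_bivector_frame U : mixed_bivector p U ->
  exists2 A, e *m A *m e^T = 0 & U = frame_bivector e A.
Proof.
move=> mU; have [pU Uv] := mU; have [ee _] := pe.
pose B := lin1_mx (adj U); have BE x : x *m B = adj U x by rewrite mul_rV_lin1.
have Bdot i j : B i j = dot (adj U (delta_mx 0 i)) (delta_mx 0 j).
  by rewrite -BE -rowE dotE trmx_delta -colE !mxE.
have Bt : B^T = - B.
  by apply/matrixP => i j; rewrite mxE [RHS]mxE !Bdot (adj_skew _ _ mU) dotC.
(* Anticommutation with the reflection 1 - 2 e^T e says that B has no diagonal blocks. *)
have BEE : B = e^T *m e *m B + B *m e^T *m e.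
  apply/row_matrixP => i; rewrite !rowE mulmxDr !mulmxA.
  have := rho_adj (delta_mx 0 i) gp mU.
  rewrite !(frame_rho pe) -/(plane_sign R n) -!BE -scalemxAl -[- (- plane_sign R n *: _)]scalerN.
  have s0 : - plane_sign R n != 0.
    rewrite oppr_eq0; apply/eqP => s0; have := plane_sign_sq R n.
    by rewrite s0 mul0r => /eqP; rewrite eq_sym oner_eq0.
  move/(scalerI s0).
  rewrite mulmxBl -scalemxAl /frame_part.
  move: (_ *m B) (_ *m B *m e^T *m e) (_ *m e^T *m e *m B) => a b c h.
  rewrite (_ : a = 2^-1 *: ((a - 2 *: b) + (a - 2 *: c)) + (c + b)).
    by rewrite h addNr scaler0 add0r.
  by apply/rowP => k; rewrite !mxE; field.
have eB : e *m B *m e^T = 0.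
  have := congr1 (fun M => e *m M *m e^T) BEE.
  rewrite mulmxDr mulmxDl !mulmxA ee mul1mx -[LHS]addr0 -!mulmxA ee mulmx1.
  by move/addrI => <-.
(* The frame bivector of A acts by A^T E - E A with E = e^T e. As B is skew, A = -B turns this into
   B E + E B, which is B by [BEE]. *)
exists (- B); first by rewrite mulmxN mulNmx eB oppr0.
pose Z := U - frame_bivector e (- B); apply/eqP; rewrite -subr_eq0 -/Z; apply/eqP.
have eB' : e *m (- B) *m e^T = 0 by rewrite mulmxN mulNmx eB oppr0.
have xZ x : vec x * Z = Z * vec x.
  apply/eqP; rewrite -subr_eq0; apply/eqP.
  rewrite (_ : _ - _ = 2 *: bracket (vec x) Z); last by rewrite bracketE; cliff_field.
  rewrite linearB /= bracket_frame_bivector -(vec_adj _ mU) -BE -linearB /=.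
  rewrite linearN /= Bt opprK mulmxN opprK -mulmxBr.
  by rewrite [X in _ - X]addrC -BEE subrr mulmx0 linear0 scaler0.
have pZ : p * Z = Z * p.
  rewrite (frame_prod pe); elim: (index_enum _) => [|i s IH]; first by rewrite big_nil mul1r mulr1.
  by rewrite !big_cons -mulrA IH !mulrA xZ.
have Zp : Z * p = 0.
  have pZ' : p * Z = - (Z * p).
    by rewrite /Z mulrBr mulrBl pU frame_bivector_anticomm // opprD.
  rewrite (_ : Z * p = 2^-1 *: (Z * p + Z * p)); last by cliff_field.
  by rewrite -{1}pZ pZ' addNr scaler0.
have := congr1 (fun a => square_sign R n *: (a * p)) Zp.
rewrite mul0r scaler0 -mulrA (grass_sq gp) cliffZr mulr1 scalerA square_sign_sq.
by rewrite scale1r.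
Qed.

Lemma orth_image A : (forall x, plane n p x -> orth (plane n p) (x *m A)) <->
  e *m A *m e^T = 0.
Proof.
split => [h|eA x].
  apply/row_matrixP => i; rewrite row0 !row_mul; apply/(orth_plane_frame _ pe)/h.
  by exists e => //; exact: row_sub.
move/(plane_proj _ gp); rewrite (frame_proj _ pe) /frame_part => <-.
by apply/(orth_plane_frame _ pe); rewrite -!mulmxA (mulmxA e A) eA !mulmx0.
Qed.

Lemma tangent_frame w : tangent_eqs p w ->
  exists A, [/\ e *m A *m e^T = 0, w = tangent_of e A
              & generator n w p = frame_bivector e A].
Proof.
move=> tw; have [A eA wA] := mixed_bivector_frame (generator_mixed gp tw).
by exists A; split=> //; rewrite tangent_of_frame // -wA generatorK.
Qed.

End TangentFrames.

Section TangentSpace.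
Variables (R : realType) (m n : nat) (p : cliff R m).
Hypothesis gp : grass n p.

(** It removes frames from the notion of tangency; the equations on the right can be differentiated
    along a field. *)
Lemma tangentP w : tangent n p w <-> tangent_eqs p w.
Proof.
split=> [[e [A [pe /(orth_image pe) eA ->]]]|].
  rewrite (tangent_of_frame pe eA); apply: (mixed_bivector_mul gp).
  exact: (frame_bivector_mixed pe).
case: gp => e pe /(tangent_frame pe)[A [eA wA _]].
by exists e, A; split=> //; apply/(orth_image pe).
Qed.

End TangentSpace.

(** * Smooth maps *)

Local Open Scope classical_set_scope.

Section Calculus.
Variables (R : realType).
Implicit Types (U V W : normedModType R).

Lemma differentiable_near0 V W (h : V -> W) (x : V) :
  (\forall y \near x, h y = 0) -> differentiable h x.
Proof.
move=> h0; have hx : h x = 0 := nbhs_singleton h0.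
have E : h \o shift x = cst (h x) + (\0 : V -> W) +o_ 0 id.
  apply: eqaddoE; rewrite funeqE => y; rewrite /= hx.
  rewrite -[LHS]add0r -[0 in LHS]addr0; congr (_ + _).
  rewrite littleoE // => eps eps0.
  have : \forall y \near (0 : V), h (y + x) = 0.
    by have := h0; rewrite (near_shift 0 x) /=; apply: filterS => z; rewrite subr0.
  by apply: filterS => z /= ->; rewrite normr0 mulr_ge0 // ltW.
have c0 : continuous (\0 : V -> W) by move=> ?; exact: cvg_cst.
apply/diff_locallyP; have -> // := @diff_unique _ _ _ h \0 x c0 E.
Qed.

Lemma differentiable_near_eq V W (f g : V -> W) (x : V) :
  (\forall y \near x, f y = g y) -> differentiable f x -> differentiable g x.
Proof.
move=> fg df; have -> : g = f + (g - f) by rewrite addrC subrK.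
apply: differentiableD => //; apply: differentiable_near0.
by apply: filterS fg => y fy; rewrite -[LHS]/(g y - f y) fy subrr.
Qed.

Lemma derive_linear V W W' (L : {linear W -> W'}) (f : V -> W) x v :
  continuous L -> differentiable f x ->
  differentiable (L \o f) x /\ 'D_v (L \o f) x = L ('D_v f x).
Proof.
move=> cL df; have dL : differentiable L (f x) by exact: linear_differentiable.
have dLf : differentiable (L \o f) x by exact: differentiable_comp.
by split=> //; rewrite !deriveE // diff_comp //= diff_lin.
Qed.

Lemma derive_bilinear V V1 V2 W (S : {bilinear V1 -> V2 -> W})
    (f : V -> V1) (g : V -> V2) x v :
  continuous (fun p : V1 * V2 => S p.1 p.2) ->
  differentiable f x -> differentiable g x ->
  differentiable (fun y => S (f y) (g y)) x /\
  'D_v (fun y => S (f y) (g y)) x = S ('D_v f x) (g x) + S (f x) ('D_v g x).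
Proof.
move=> cS df dg.
have dfg : differentiable (fun y => (f y, g y)) x by exact: differentiable_pair.
have dS p : differentiable (fun p : V1 * V2 => S p.1 p.2) p := differentiable_bilin p cS.
have e : (fun y => S (f y) (g y)) =
  (fun p : V1 * V2 => S p.1 p.2) \o (fun y => (f y, g y)) by [].
have dSfg : differentiable (fun y => S (f y) (g y)) x.
  by rewrite e; exact: differentiable_comp.
split=> //; rewrite !deriveE // {1}e diff_comp //= diff_bilin //=.
by rewrite diff_pair //= addrC.
Qed.

Lemma derive_scale V W (k : V -> R) (f : V -> W) x v :
  differentiable k x -> differentiable f x ->
  differentiable (fun y => k y *: f y) x /\
  'D_v (fun y => k y *: f y) x = 'D_v k x *: f x + k x *: 'D_v f x.
Proof.
move=> dk df.
have bil : bilinear_for *:%R *:%R (fun (a : R) (b : W) => a *: b).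
  split => [u' a u w | u a v' w].
    by rewrite scalerDl; congr (_ + _); exact: esym (scalerA _ _ _).
  rewrite scalerDr; congr (_ + _).
  by rewrite (scalerA u a) mulrC -scalerA.
pose B := bilinear_isBilinear.Build R R W W *:%R *:%R _ bil.
pose S : {bilinear R -> W -> W} := HB.pack (fun (a : R) (b : W) => a *: b) B.
by apply: (@derive_bilinear _ _ _ _ S) => //; exact: scale_continuous.
Qed.

Lemma Ck_ext V W k (O : set V) (f g : V -> W) : open O ->
  (forall x, O x -> f x = g x) -> Ck k O f -> Ck k O g.
Proof.
move=> oO; elim: k f g => [|k IH] f g fg /=.
  move=> cf x Ox; have near_fg : \forall y \near x, f y = g y.
    by apply: filterS (open_nbhs_nbhs (conj oO Ox)) => y; exact: fg.
  have := cf x Ox; rewrite /prop_for /continuous_at -(fg x Ox) => h.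
  exact: cvg_trans (near_eq_cvg near_fg) h.
move=> [df cf]; have near_fg x : O x -> \forall y \near x, f y = g y.
  by move=> Ox; apply: filterS (open_nbhs_nbhs (conj oO Ox)) => y; exact: fg.
split=> [x Ox|v]; first exact: differentiable_near_eq (near_fg x Ox) (df x Ox).
by apply: IH (cf v) => x Ox; apply: near_eq_derive; exact: near_fg.
Qed.

Lemma Ck_sub V W k (O O' : set V) (f : V -> W) : O' `<=` O -> Ck k O f -> Ck k O' f.
Proof.
move=> OO'; elim: k f => [|k IH] f /=; first by move=> cf x /OO'; exact: cf.
by move=> [df cf]; split=> [x /OO'|v]; [exact: df|exact: IH].
Qed.

Lemma Ck_pred V W k (O : set V) (f : V -> W) : Ck k.+1 O f -> Ck k O f.
Proof.
elim: k f => [|k IH] f [df cf]; first by move=> x /df; exact: differentiable_continuous.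
by split=> // v; apply: IH; exact: cf.
Qed.

Lemma CkD V W k (O : set V) (f g : V -> W) : open O ->
  Ck k O f -> Ck k O g -> Ck k O (fun x => f x + g x).
Proof.
move=> oO; elim: k f g => [|k IH] f g /=.
  by move=> cf cg x Ox; apply: continuousD; [exact: cf|exact: cg].
move=> [df cf] [dg cg]; split=> [x Ox|v].
  by apply: differentiableD; [exact: df|exact: dg].
apply: Ck_ext (IH _ _ (cf v) (cg v)) => // x Ox.
by rewrite -[RHS]/('D_v (f + g) x) deriveD //; apply: diff_derivable; [exact: df|exact: dg].
Qed.

Lemma Ck_cst V W k (O : set V) (c : W) : Ck k O (fun _ : V => c).
Proof.
elim: k c => [|k IH] c /=; first by move=> x _; exact: cvg_cst.
split=> [x _|v]; first exact: differentiable_cst.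
have -> : 'D_v (fun=> c) = (fun=> 0) :> (V -> W) by apply/funext => x; exact: derive_cst.
exact: IH.
Qed.

Lemma Ck_linear V W W' k (O : set V) (L : {linear W -> W'}) (f : V -> W) : open O ->
  continuous L -> Ck k O f -> Ck k O (fun x => L (f x)).
Proof.
move=> oO cL; elim: k f => [|k IH] f /=.
  by move=> cf x Ox; apply: continuous_comp; [exact: cf|exact: cL].
move=> [df cf]; split=> [x Ox|v]; first by have [] := derive_linear 0 cL (df x Ox).
by apply: Ck_ext (IH _ (cf v)) => // x Ox; have [_ ->] := derive_linear v cL (df x Ox).
Qed.

Lemma Ck_scale V W k (O : set V) (a : V -> R) (f : V -> W) : open O ->
  Ck k O a -> Ck k O f -> Ck k O (fun x => a x *: f x).
Proof.
move=> oO; elim: k a f => [|k IH] a f.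
  by move=> ca cf x Ox; apply: cvgZ; [exact: ca|exact: cf].
move=> Ca Cf; have [da ca] := Ca; have [df cf] := Cf.
split=> [x Ox|v]; first by have [] := derive_scale 0 (da x Ox) (df x Ox).
apply: Ck_ext (CkD oO (IH _ _ (ca v) (Ck_pred Cf)) (IH _ _ (Ck_pred Ca) (cf v))) => // x Ox.
by have [_ ->] := derive_scale v (da x Ox) (df x Ox).
Qed.

Lemma Ck_sum V W k (O : set V) (I : Type) (r : seq I) (f : I -> V -> W) : open O ->
  (forall i, Ck k O (f i)) -> Ck k O (fun x => \sum_(i <- r) f i x).
Proof.
move=> oO Cf; elim: r => [|i r IH].
  by apply: Ck_ext (Ck_cst _ O 0) => // x _; rewrite big_nil.
by apply: Ck_ext (CkD oO (Cf i) IH) => // x _; rewrite big_cons.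
Qed.

Lemma continuous_sum (T : topologicalType) W (I : Type) (r : seq I) (f : I -> T -> W) :
  (forall i, continuous (f i)) -> continuous (fun x => \sum_(i <- r) f i x).
Proof.
move=> cf; elim: r => [|i r IH].
  by under eq_fun do rewrite big_nil; move=> x; exact: cvg_cst.
by under eq_fun do rewrite big_cons; move=> x; apply: continuousD; [exact: cf|exact: IH].
Qed.

Lemma linear_rV_continuous N W (L : {linear 'rV[R]_N -> W}) : continuous L.
Proof.
have -> : L = (fun x => \sum_(i < N) x 0 i *: L (delta_mx 0 i)) :> (_ -> _).
  by apply/funext => x; rewrite {1}[x]row_sum_delta linear_sum; apply: eq_bigr => i _; rewrite linearZ.
apply: continuous_sum => i x; apply: cvgZr_tmp; first exact: (@nbhs_filter _ x).
exact: coord_continuous.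
Qed.

Definition coord_fun N i (x : 'rV[R]_N) : R := x 0 i.
Lemma coord_is_linear N i : linear (@coord_fun N i).
Proof. by move=> a x y; rewrite /coord_fun !mxE. Qed.
HB.instance Definition _ N i :=
  GRing.isLinear.Build R 'rV[R]_N R *:%R (@coord_fun N i) (@coord_is_linear N i).

Lemma Ck_coord V N k (O : set V) (f : V -> 'rV[R]_N) i : open O ->
  Ck k O f -> Ck k O (fun x => f x 0 i).
Proof.
by move=> oO; apply: (@Ck_linear _ _ _ _ _ (@coord_fun N i)) => //; exact: linear_rV_continuous.
Qed.

Lemma derive_coord V N (f : V -> 'rV[R]_N) i x v : differentiable f x ->
  differentiable (fun y => f y 0 i) x /\ 'D_v (fun y => f y 0 i) x = 'D_v f x 0 i.
Proof.
by apply: (@derive_linear _ _ _ (@coord_fun N i)); exact: linear_rV_continuous.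
Qed.

Section Bilinear.
Variables (N N' : nat) (W : normedModType R) (B : 'rV[R]_N -> 'rV[R]_N' -> W).
Hypotheses (Bl : forall y, linear (fun x => B x y)) (Br : forall x, linear (B x)).

Let mixin := bilinear_isBilinear.Build R 'rV[R]_N 'rV[R]_N' W *:%R *:%R _
  (conj (fun y => Bl y) Br).
Let S : {bilinear 'rV[R]_N -> 'rV[R]_N' -> W} := HB.pack B mixin.

Let BE x y : B x y = \sum_(i < N) x 0 i *: B (delta_mx 0 i) y.
Proof.
pose M := GRing.isLinear.Build R 'rV[R]_N W *:%R _ (Bl y).
pose L : {linear 'rV[R]_N -> W} := HB.pack (fun x => B x y) M.
rewrite {1}[x]row_sum_delta -[LHS]/(L _) linear_sum.
by apply: eq_bigr => i _; rewrite linearZ.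
Qed.

Lemma bilinear_rV_continuous : continuous (fun p : 'rV[R]_N * 'rV[R]_N' => B p.1 p.2).
Proof.
have -> : (fun p => B p.1 p.2) =
    (fun p => \sum_(i < N) p.1 0 i *: S (delta_mx 0 i) p.2).
  by apply/funext => p; rewrite BE.
apply: continuous_sum => i p; apply: cvgZ.
  apply: (@continuous_comp _ _ _ fst (fun x : 'rV[R]_N => x 0 i)); first exact: cvg_fst.
  exact: coord_continuous.
apply: (@continuous_comp _ _ _ snd (S (delta_mx 0 i))); first exact: cvg_snd.
exact: linear_rV_continuous.
Qed.

Lemma derive_rV_bilinear V (f : V -> 'rV[R]_N) (g : V -> 'rV[R]_N') x v :
  differentiable f x -> differentiable g x ->
  differentiable (fun y => B (f y) (g y)) x /\
  'D_v (fun y => B (f y) (g y)) x = B ('D_v f x) (g x) + B (f x) ('D_v g x).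
Proof. exact: (derive_bilinear (S := S) v bilinear_rV_continuous). Qed.

(** Expanding the first argument in the canonical basis leaves sums of scalar functions times linear
    images. *)
Lemma Ck_bilinear V k (O : set V) (f : V -> 'rV[R]_N) (g : V -> 'rV[R]_N') : open O ->
  Ck k O f -> Ck k O g -> Ck k O (fun x => B (f x) (g x)).
Proof.
move=> oO Cf Cg.
apply: (@Ck_ext _ _ _ _ (fun x => \sum_(i < N) f x 0 i *: S (delta_mx 0 i) (g x)) _ oO).
  by move=> x _; rewrite BE.
apply: Ck_sum => // i; apply: Ck_scale => //; first exact: Ck_coord.
by apply: Ck_linear => //; exact: linear_rV_continuous.
Qed.
End Bilinear.

End Calculus.

(** * Symmetry of second derivatives *)

Section Schwarz.
Variables (R : realType) (V : normedModType R).
Implicit Types (f : V -> R) (p a b : V) (O : set V).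

Lemma is_derive_line (W : normedModType R) (f : V -> W) p a (s : R) :
  differentiable f (p + s *: a) ->
  is_derive s 1 (fun s => f (p + s *: a)) ('D_a f (p + s *: a)).
Proof.
move=> df; pose l : R -> V := cst p + ( *:%R ^~ a).
have dl : is_diff s l (0 + ( *:%R ^~ a)) by apply: is_diffD.
have dfl : differentiable (f \o l) s by apply: differentiable_comp => //; exact: ex_diff.
apply: DeriveDef; first exact: diff_derivable.
rewrite -[X in 'D_1 X s]/(f \o l) deriveE // diff_comp //=.
by rewrite diff_val deriveE // /= fctE /= add0r scale1r.
Qed.

(** The mean value theorem is used twice: for the difference f(p + s a + h b) - f(p + s a) in s,
    then for the derivative of f along a in t. *)
Lemma second_difference f O p a b (h : R) : 0 < h -> Ck 2 O f ->
  (forall s t, 0 <= s <= h -> 0 <= t <= h -> O (p + s *: a + t *: b)) ->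
  exists s t, [/\ 0 <= s <= h, 0 <= t <= h &
    f (p + h *: a + h *: b) - f (p + h *: a) - (f (p + h *: b) - f p) =
    'D_b ('D_a f) (p + s *: a + t *: b) * h * h].
Proof.
move=> h0 [df cf] sq; have [ddf _] := cf a.
have hh : 0 <= h <= h by rewrite lexx ltW.
have z0 : 0 <= (0 : R) <= h by rewrite lexx ltW.
pose g s := f (p + s *: a + h *: b) - f (p + s *: a).
have dg s : 0 <= s <= h -> is_derive s 1 g ('D_a f (p + s *: a + h *: b) - 'D_a f (p + s *: a)).
  move=> sh; apply: is_deriveB.
    have := sq s h sh hh; rewrite addrAC => /df /is_derive_line.
    by congr is_derive; apply/funext => t; rewrite addrAC.
  by apply: is_derive_line; apply: df; rewrite -[_ + _]addr0 -(scale0r b); exact: sq.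
have [s sh gs] : exists2 s, s \in `]0, h[%R & g h - g 0 =
    ('D_a f (p + s *: a + h *: b) - 'D_a f (p + s *: a)) * (h - 0).
  apply: MVT => // [x|]; first by rewrite in_itv /= => /andP[/ltW ? /ltW ?]; apply: dg; apply/andP.
  by apply: derivable_within_continuous => x; rewrite in_itv /= => /dg [].
have {}sh : 0 <= s <= h by move: sh; rewrite in_itv /= => /andP[/ltW -> /ltW ->].
have dk t : 0 <= t <= h -> is_derive t 1 (fun t => 'D_a f (p + s *: a + t *: b))
    ('D_b ('D_a f) (p + s *: a + t *: b)).
  by move=> th; apply: is_derive_line; apply: ddf; exact: sq.
pose k t := 'D_a f (p + s *: a + t *: b).
pose k' t := 'D_b ('D_a f) (p + s *: a + t *: b).
have {}dk t : 0 <= t <= h -> is_derive t 1 k (k' t) by exact: dk.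
have [t th kt] : exists2 t, t \in `]0, h[%R & k h - k 0 = k' t * (h - 0).
  apply: (MVT h0) => [x|].
    by rewrite in_itv /= => /andP[/ltW ? /ltW ?]; apply: dk; apply/andP.
  by apply: derivable_within_continuous => x; rewrite in_itv /= => /dk [].
have {}th : 0 <= t <= h by move: th; rewrite in_itv /= => /andP[/ltW -> /ltW ->].
exists s, t; split=> //.
by move: gs kt; rewrite /g /k /k' !scale0r !addr0 !subr0 => -> ->.
Qed.

(** The second difference is symmetric in a and b, so the two mixed derivatives take a common value
    at points of an arbitrarily small parallelogram; continuity at p concludes. *)
Lemma schwarz_scalar f O p a b : open O -> O p -> Ck 2 O f ->
  'D_a ('D_b f) p = 'D_b ('D_a f) p.
Proof.
move=> oO Op Cf; apply/eqP; rewrite -subr_eq0 -normr_le0.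
apply/ler_addgt0Pl => e e0; rewrite addr0.
have cab v w : \forall x \near p, `|'D_w ('D_v f) p - 'D_w ('D_v f) x| < e / 2.
  have [_ /(_ v)[_ /(_ w)]] := Cf; move=> /(_ p Op) /cvgrPdist_lt; apply.
  by rewrite divr_gt0.
have : \forall x \near p, [/\ O x, `|'D_a ('D_b f) p - 'D_a ('D_b f) x| < e / 2
     & `|'D_b ('D_a f) p - 'D_b ('D_a f) x| < e / 2].
  have Ox : \forall x \near p, O x := open_nbhs_nbhs (conj oO Op).
  by apply: filterS3 Ox (cab b a) (cab a b) => x; split.
move=> /nbhs_ballP[d /= d0 dO].
have ab0 : 0 < `|a| + `|b| + 1 by rewrite ltr_wpDl // addr_ge0.
have [h h0 hd] : exists2 h, 0 < h & h * (`|a| + `|b|) < d.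
  (* The + 1 keeps the denominator positive when a = b = 0. *)
  exists (d / (2 * (`|a| + `|b| + 1))); first by rewrite divr_gt0 // mulr_gt0.
  rewrite mulrAC ltr_pdivrMr ?mulr_gt0 // ltr_pM2l //.
  by rewrite mulr_natl mulr2n ltr_wpDl ?ltrDl ?addr_ge0 // ltW.
have inball s t : 0 <= s <= h -> 0 <= t <= h -> ball p d (p + s *: a + t *: b).
  move=> /andP[s0 sh] /andP[t0 th]; rewrite -ball_normE /= -addrA opprD addNKr normrN.
  apply: le_lt_trans hd; apply: le_trans (ler_normD _ _) _.
  rewrite !normrZ mulrDr !ger0_norm //.
  by apply: lerD; apply: ler_wpM2r.
have sq s t : 0 <= s <= h -> 0 <= t <= h -> O (p + s *: a + t *: b).
  by move=> sh th; have [] := dO _ (inball s t sh th).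
have inball' s t : 0 <= s <= h -> 0 <= t <= h -> ball p d (p + s *: b + t *: a).
  by move=> sh th; rewrite addrAC; exact: inball.
have sq' s t : 0 <= s <= h -> 0 <= t <= h -> O (p + s *: b + t *: a).
  by move=> sh th; have [] := dO _ (inball' s t sh th).
have [s [t [sh th E1]]] := second_difference h0 Cf sq.
have [s' [t' [sh' th' E2]]] := second_difference h0 Cf sq'.
have E : 'D_b ('D_a f) (p + s *: a + t *: b) = 'D_a ('D_b f) (p + s' *: b + t' *: a).
  have hn0 : h * h != 0 by rewrite mulf_neq0 // gt_eqF.
  move: E1 E2; rewrite (addrAC p (h *: b) (h *: a)).
  move: (f _) (f _) (f _) (f _) => A B C D; move: ('D_b _ _) ('D_a _ _) => X Y E1 E2.
  by apply: (mulIf hn0); rewrite !mulrA -E1 -E2; ring.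
have [_ _ l1] := dO _ (inball s t sh th).
have [_ l2 _] := dO _ (inball' s' t' sh' th').
rewrite E in l1; set x := 'D_a ('D_b f) p in l2 *; set y := 'D_b ('D_a f) p in l1 *.
set z := 'D_a ('D_b f) _ in l1 l2.
rewrite (_ : x - y = (x - z) - (y - z)); last by ring.
apply: le_trans (ler_normB _ _) _.
by rewrite (splitr e); exact: ltW (ltrD l2 l1).
Qed.

(** Coordinatewise, because the mean value theorem is scalar. *)
Lemma schwarz N (F : V -> 'rV[R]_N) O p a b : open O -> O p -> Ck 2 O F ->
  'D_a ('D_b F) p = 'D_b ('D_a F) p.
Proof.
move=> oO Op CF; have [dF cF] := CF; apply/rowP => i.
have DL v w : 'D_v ('D_w (fun x => F x 0 i)) p = 'D_v ('D_w F) p 0 i.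
  have [dDw _] := cF w; have [_ e] := derive_coord i v (dDw p Op).
  apply: etrans _ e.
  apply: near_eq_derive; apply: filterS (open_nbhs_nbhs (conj oO Op)) => x Ox.
  by have [_ ->] := derive_coord i w (dF x Ox).
have CL : Ck 2 O (fun x => F x 0 i) := Ck_coord i oO CF.
have E := schwarz_scalar a b oO Op CL.
apply: etrans (esym (DL a b)) _.
apply: etrans _ (DL b a).
exact: E.
Qed.

End Schwarz.

(** * Derivatives along the Grassmannian *)

Section TangentialDerivative.
Variables (R : realType) (m n : nat).
Implicit Types (p q w : cliff R m) (W : normedModType R).

Lemma orthonormal_rows (e : 'M[R]_(n, m)) :
  (forall i j, dot (row i e) (row j e) = (i == j)%:R) -> e *m e^T = 1%:M.
Proof.
by move=> h; apply/matrixP => i j; rewrite [RHS]mxE -h /dot mxE; apply: eq_bigr => k _; rewrite !mxE.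
Qed.

(** Only row i moves: it is rotated towards the unit normal vector y, which keeps the frame
    orthonormal. *)
Lemma grass_rotation p (e : 'M[R]_(n, m)) i (y : 'rV[R]_m) (t : R) :
  pos_frame p e -> y *m e^T = 0 -> dot y y = 1 ->
  grass n (cos t *: p + sin t *: (vec (row i e) * vec y * p)).
Proof.
move=> pe ye yy; pose z := cos t *: row i e + sin t *: y.
have yj j : dot y (row j e) = 0 by rewrite dot_row ye mxE.
have zj j : j != i -> dot z (row j e) = 0.
  by move=> ji; rewrite dotDl !dotZl yj (frame_orth pe) 1?eq_sym // !mulr0 addr0.
exists (\matrix_(k < n) (if k == i then z else row k e)); split.
  apply: orthonormal_rows => j k; rewrite !rowK.
  case: (eqVneq j i) => [->|ji]; case: (eqVneq k i) => [ki|ki].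
  - rewrite dotDl !dotZl !dotDr !dotZr yy (frame_dot pe) eqxx.
    by rewrite (dotC (row i e) y) yj !mulr0 addr0 add0r !mulr1 -!expr2 cos2Dsin2.
  - by rewrite zj // eq_sym (negbTE ki).
  - by rewrite ki dotC zj // (negbTE ji).
  - by rewrite (frame_dot pe).
rewrite (wedge_rows_replace pe) // linearD !(linearZZ (@vec R m)) !mulrDl !cliffZl.
rewrite vec_sq (frame_dot pe) eqxx (@vec_anticommutes _ _ y) //.
rewrite opprD -!scalerN scaleN1r mulN1r !mulNr !opprK //.
Qed.

Lemma derive_rotation_eq0 W (F : cliff R m -> W) p (e : 'M[R]_(n, m)) i (x : 'rV[R]_m) :
  pos_frame p e -> x *m e^T = 0 -> differentiable F p ->
  (\forall q \near p, grass n q -> F q = 0) -> 'd F p (vec (row i e) * vec x * p) = 0.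
Proof.
move=> pe xe dF F0.
have [->|x0] := eqVneq x 0; first by rewrite linear0 mulr0 mul0r linear0.
(* The circle needs a unit normal vector; linearity of the differential restores the length. *)
pose c := Num.sqrt (dot x x); pose y := c^-1 *: x.
have xx : 0 < dot x x.
  by rewrite lt_def dot_eq0 x0 /= /dot sumr_ge0 // => j _; rewrite -expr2 sqr_ge0.
have c0 : c != 0 by rewrite gt_eqF // sqrtr_gt0.
have yy : dot y y = 1.
  by rewrite dotZl dotZr mulrA -invfM -expr2 sqr_sqrtr ?ltW // mulVf // gt_eqF.
have ye : y *m e^T = 0 by rewrite -scalemxAl xe scaler0.
have -> : x = c *: y by rewrite scalerA mulfV // scale1r.
rewrite (linearZZ (@vec R m)) cliffZr cliffZl linearZ.
apply/eqP; rewrite scaler_eq0 (negbTE c0) /=; apply/eqP.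
set v := _ * _ * p; pose g : R -> cliff R m := fun t => cos t *: p + sin t *: v.
have dtrig (k : R -> R) k' (a : cliff R m) : is_derive (0 : R) 1 k k' ->
    differentiable (fun t => k t *: a) (0 : R) /\ 'D_1 (fun t => k t *: a) (0 : R) = k' *: a.
  move=> [dk Dk]; have dk' : differentiable k 0 by apply/derivable1_diffP.
  have [dka ->] := @derive_scale R R _ k (cst a) 0 1 dk' (differentiable_cst a _).
  by rewrite derive_cst scaler0 addr0 Dk.
have [dc Dc] := dtrig _ _ p (is_derive_cos 0).
have [ds Ds] := dtrig _ _ v (is_derive_sin 0).
have dg : differentiable g 0 by exact: differentiableD.
have Dg : 'D_1 g 0 = v.
  rewrite [LHS]deriveD ?Dc ?Ds; [|exact: diff_derivable|exact: diff_derivable].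
  by rewrite sin0 cos0 oppr0 scale0r add0r scale1r.
have g0 : g 0 = p by rewrite /g sin0 cos0 scale0r addr0 scale1r.
have dF' : differentiable F (g 0) by rewrite g0.
have Fg0 : \forall t \near (0 : R), (F \o g) t = 0.
  have /(_ _) := differentiable_continuous dg; rewrite /prop_for /continuous_at g0.
  move/(_ _ F0) => Fg.
  have {}Fg : \forall t \near (0 : R), grass n (g t) -> F (g t) = 0 by exact: Fg.
  by apply: filterS Fg => t; apply; exact: grass_rotation.
have : 'D_1 (F \o g) 0 = 0 by rewrite (near_eq_derive (g := cst 0)) // derive_cst.
rewrite deriveE; last exact: differentiable_comp.
have Dg' : 'd g 0 1 = v by rewrite -Dg (deriveE _ dg).
by rewrite (diff_comp dg dF') /= Dg' g0.
Qed.

(** The frame form of w is a sum of initial velocities of such circles, along each of which F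
    vanishes near p. *)
Lemma derive_tangent_eq0 W (F : cliff R m -> W) p w :
  grass n p -> tangent n p w -> differentiable F p ->
  (\forall q \near p, grass n q -> F q = 0) -> 'D_w F p = 0.
Proof.
move=> gp /(tangentP gp) tw dF F0; have [e pe] := gp.
have [A [eA wA _]] := tangent_frame pe tw.
rewrite deriveE // wA (tangent_of_frame pe eA) /frame_bivector mulr_suml linear_sum.
rewrite big1 // => i _; apply: (derive_rotation_eq0 _ pe) => //.
by rewrite -!row_mul eA row0.
Qed.

(** The extension picked by [get] is unknown, but its difference with F vanishes on the Grassmannian
    near p. *)
Lemma dalongE W (f F : cliff R m -> W) p w :
  grass n p -> tangent n p w -> local_extension (grass n) f p F ->
  dalong (grass n) f p w = 'D_w F p.
Proof.
move=> gp tw EF; rewrite /dalong; set S := (X in get X).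
have [G EG ->] : S (get S) by apply: (@getI _ _ ('D_w F p)); exists F.
have [D [oD Dp CF Ff]] := EF; have [D' [oD' Dp' CG Gf]] := EG.
have [dF _] := CF 1%N; have [dG _] := CG 1%N.
apply/eqP; rewrite -subr_eq0 -deriveB; [|exact: diff_derivable (dG _ _)|exact: diff_derivable (dF _ _)].
apply/eqP; apply: derive_tangent_eq0 => //.
  by apply: differentiableB; [exact: dG|exact: dF].
have DD : \forall q \near p, D q /\ D' q.
  by apply: filterI; apply: open_nbhs_nbhs.
by apply: filterS DD => q [Dq D'q] gq; rewrite -[LHS]/(G q - F q) Ff // Gf // subrr.
Qed.

End TangentialDerivative.

Section SmoothProjections.
Variables (R : realType) (m : nat).
Implicit Types (p q w : cliff R m) (D : set (cliff R m)) (s : cliff R m -> 'rV[R]_m).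

Lemma cliff_mul_linearl (b : cliff R m) : linear (fun a => a * b).
Proof. exact: cmul_linearl. Qed.
Lemma cliff_mul_linearr (a : cliff R m) : linear (fun b => a * b).
Proof. exact: cmul_linear. Qed.

Lemma Ck_mul k D (f g : cliff R m -> cliff R m) : open D ->
  Ck k D f -> Ck k D g -> Ck k D (fun q => f q * g q).
Proof. move=> oD Cf Cg; exact: (@Ck_bilinear R _ _ _ (@cmul R m) cliff_mul_linearl cliff_mul_linearr). Qed.

Lemma derive_mul (f g : cliff R m -> cliff R m) p w :
  differentiable f p -> differentiable g p ->
  differentiable (fun q => f q * g q) p /\
  'D_w (fun q => f q * g q) p = ('D_w f p : cliff R m) * g p + f p * ('D_w g p : cliff R m).
Proof. move=> df dg; exact: (@derive_rV_bilinear R _ _ _ (@cmul R m) cliff_mul_linearl cliff_mul_linearr). Qed.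

Lemma vec_continuous : continuous (@vec R m).
Proof. exact: (@linear_rV_continuous R m _ (@vec R m)). Qed.
Lemma unvec_continuous : continuous (@unvec R m).
Proof. exact: (@linear_rV_continuous R _ _ (@unvec R m)). Qed.

Lemma Ck_id k D : Ck k D (fun q : cliff R m => q).
Proof.
case: k => [|k]; first by move=> x _; exact: cvg_id.
split=> [x _|v]; first by [].
have -> : 'D_v (fun q : cliff R m => q) = (fun=> v) by apply/funext => x; exact: derive_id.
exact: Ck_cst.
Qed.

Lemma Ck_proj k c D s : open D -> Ck k D s -> Ck k D (fun q => proj c q (s q)).
Proof.
move=> oD Cs; rewrite /proj /rho.
apply: (Ck_scale oD (Ck_cst k D (2^-1 : R))); apply: (CkD oD Cs).
apply: (Ck_scale oD (Ck_cst k D (c : R))).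
apply: (Ck_linear (L := @unvec R m) oD unvec_continuous).
apply: (Ck_mul oD _ (Ck_id k D)); apply: (Ck_mul oD (Ck_id k D)).
exact: (Ck_linear (L := @vec R m) oD vec_continuous Cs).
Qed.

(** The derivative of q |-> [proj c q x] at p along w. *)
Definition dproj (c : R) p w (x : 'rV[R]_m) : 'rV[R]_m :=
  (2^-1 * c) *: unvec (w * vec x * p + p * vec x * w).

Lemma derive_proj c p w s : differentiable s p ->
  'D_w (fun q => proj c q (s q)) p = dproj c p w (s p) + proj c p ('D_w s p).
Proof.
move=> ds; have dv : differentiable (fun q => vec (s q)) p.
  by have [] := @derive_linear _ _ _ _ (@vec R m) s p 0 vec_continuous ds.
have Dv : 'D_w (fun q => vec (s q)) p = vec ('D_w s p).
  by have [] := @derive_linear _ _ _ _ (@vec R m) s p w vec_continuous ds.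
have [d1 D1] := derive_mul w (ex_diff (is_diff_def := is_diff_id p)) dv.
have [d2 D2] := derive_mul w d1 (ex_diff (is_diff_def := is_diff_id p)).
have [d3 D3] := @derive_linear _ _ _ _ (@unvec R m) _ p w unvec_continuous d2.
set f3 := (_ \o _) in d3 D3.
have -> : (fun q => proj c q (s q)) = 2^-1 *: (s + c *: f3) by [].
clearbody f3; have d3' : derivable f3 p w by exact: diff_derivable.
have d4 : derivable (c *: f3) p w by exact: derivableZ.
have d0 : derivable s p w by exact: diff_derivable.
rewrite (deriveZ _ (derivableD d0 d4)) (deriveD d0 d4) (deriveZ _ d3').
rewrite D3 D2 D1 Dv derive_id /dproj /proj /rho.
rewrite !mulrDl !(linearD (@unvec R m)).
by apply/rowP => i; rewrite !mxE; ring.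
Qed.

End SmoothProjections.

(** * Tangency of the Lie bracket *)

Section LieBracket.
Variables (R : realType) (m n : nat).
Implicit Types (p q u v w : cliff R m).

(** Differentiating B(q, Y q) = 0 along X gives B(X, Y) + B(p, D_X Y) = 0. Exchanging X and Y and
    subtracting, the symmetric terms cancel. *)
Lemma symmetric_bilinear_bracket (N := #|{set 'I_m}|) N' (B : 'rV[R]_N -> 'rV[R]_N -> 'rV[R]_N')
    (X Y Xe Ye : cliff R m -> cliff R m) p :
  (forall y, linear (fun x => B x y)) -> (forall x, linear (B x)) ->
  (forall x y, B x y = B y x) ->
  (forall q w, grass n q -> tangent n q w -> B q w = 0) ->
  grass n p -> vector_field n X -> vector_field n Y ->
  local_extension (@grass R m n) X p Xe -> local_extension (@grass R m n) Y p Ye ->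
  B p ('D_(X p) Ye p - 'D_(Y p) Xe p) = 0.
Proof.
move=> Bl Br Bs B0 gp [_ tX] [_ tY] [D [oD Dp CX EX]] [D' [oD' Dp' CY EY]].
have key (Z Ze : cliff R m -> cliff R m) C w : open C -> C p ->
    (forall k, Ck k C Ze) -> (forall q, C q -> grass n q -> Ze q = Z q) ->
    (forall q, grass n q -> tangent n q (Z q)) -> tangent n p w ->
    B w (Z p) + B p ('D_w Ze p) = 0.
  move=> oC Cp CZ EZ tZ tw.
  have [dZ _] := CZ 1%N; have dZp := dZ p Cp.
  have [dB] := derive_rV_bilinear Bl Br w (ex_diff (is_diff_def := is_diff_id p)) dZp.
  rewrite derive_id (EZ p Cp gp) => <-; apply: (derive_tangent_eq0 gp tw dB).
  apply: filterS (open_nbhs_nbhs (conj oC Cp)) => q Cq gq.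
  by rewrite EZ // B0 //; exact: tZ.
have eY := key Y Ye D' (X p) oD' Dp' CY EY tY (tX p gp).
have eX := key X Xe D (Y p) oD Dp CX EX tX (tY p gp).
rewrite -(subrr (0 : 'rV[R]_N')) -{1}eY -eX (Bs (Y p)) opprD addrACA subrr add0r.
by rewrite -[_ - 'D_(Y p) Xe p]addrC -scaleN1r Br scaleN1r addrC.
Qed.

Lemma lie_bracket_tangent (X Y Xe Ye : cliff R m -> cliff R m) p :
  grass n p -> vector_field n X -> vector_field n Y ->
  local_extension (@grass R m n) X p Xe -> local_extension (@grass R m n) Y p Ye ->
  tangent n p ('D_(X p) Ye p - 'D_(Y p) Xe p).
Proof.
move=> gp vX vY EX EY; apply/(tangentP gp); split.
  pose B (q w : cliff R m) : cliff R m := q * w + w * q.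
  apply: (symmetric_bilinear_bracket (B := B) _ _ _ _ gp vX vY EX EY).
  - by move=> w k a b; rewrite /B mulrDl mulrDr !cliffZl !cliffZr; cliff_linear.
  - by move=> w k a b; rewrite /B mulrDl mulrDr !cliffZl !cliffZr; cliff_linear.
  - by move=> a b; rewrite /B addrC.
  - by move=> q w gq /(tangentP gq)[].
move=> x; rewrite /is_vec; apply/esym/eqP; rewrite -subr_eq0; apply/eqP.
pose S (q w : cliff R m) : cliff R m := w * vec x * q + q * vec x * w.
(* Being a vector is turned into an equation: [N] removes the degree-one part, so it vanishes
   exactly on vectors. *)
pose N (a : cliff R m) : cliff R m := a - vec (unvec a).
have linN k a b : N (k *: a + b) = k *: N a + N b.
  by rewrite /N (linearP (@unvec R m)) (linearP (@vec R m)); cliff_linear.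
have SC a b : S a b = S b a by rewrite /S addrC.
have linS a k b c : S a (k *: b + c) = k *: S a b + S a c.
  by rewrite /S !(mulrDl, mulrDr) !(cliffZl, cliffZr); cliff_linear.
pose B q w := N (S q w).
apply: (symmetric_bilinear_bracket (B := B) _ _ _ _ gp vX vY EX EY).
- by move=> w k a b; rewrite /B !(SC _ w) linS linN.
- by move=> w k a b; rewrite /B linS linN.
- by move=> a b; rewrite /B SC.
- by move=> q w gq /(tangentP gq)[_ /(_ x)]; rewrite /B /N => ->; rewrite subrr.
Qed.


End LieBracket.

(** * Covariant derivatives and curvature *)

Section DerivativeAlongFields.
Variables (R : realType) (N N' : nat).
Implicit Types (S : 'rV[R]_N -> 'rV[R]_N') (Y : 'rV[R]_N -> 'rV[R]_N).
Implicit Types (D : set 'rV[R]_N) (p q v w : 'rV[R]_N).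

Lemma derive_row_sum S p v : differentiable S p ->
  'D_v S p = \sum_(j < N) v 0 j *: 'D_(delta_mx 0 j) S p.
Proof.
move=> dS; rewrite deriveE // {1}[v]row_sum_delta linear_sum.
by apply: eq_bigr => j _; rewrite linearZ deriveE.
Qed.

Lemma deriveB_dir S p v w : differentiable S p ->
  'D_(v - w) S p = 'D_v S p - 'D_w S p.
Proof. by move=> dS; rewrite !deriveE // linearB. Qed.

Lemma Ck_derive_field D S Y : open D -> (forall k, Ck k D S) -> (forall k, Ck k D Y) ->
  forall k, Ck k D (fun q => 'D_(Y q) S q).
Proof.
move=> oD CS CY k.
have [dS _] := CS 1%N.
apply: (@Ck_ext _ _ _ _ _ (fun q => \sum_(j < N) Y q 0 j *: 'D_(delta_mx 0 j) S q) _ oD).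
  by move=> q Dq; rewrite [RHS]derive_row_sum //; exact: dS.
apply: (Ck_sum _ oD) => j; apply: (Ck_scale oD); first exact: (Ck_coord j oD (CY k)).
by have [_ C] := CS k.+1; exact: C.
Qed.

Let derive_field_sum D S Y p w : open D -> D p -> Ck 2 D S -> Ck 1 D Y ->
  'D_w (fun q => 'D_(Y q) S q) p =
  \sum_(j < N) ('D_w Y p 0 j *: 'D_(delta_mx 0 j) S p
                + Y p 0 j *: 'D_w ('D_(delta_mx 0 j) S) p).
Proof.
move=> oD Dp [dS dDS] [dY _].
pose h j q := Y q 0 j *: 'D_(delta_mx 0 j) S q.
have Eh : \forall q \near p, (fun q => 'D_(Y q) S q) q = (\sum_(j < N) h j) q.
  apply: filterS (open_nbhs_nbhs (conj oD Dp)) => q Dq.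
  by rewrite fct_sumE derive_row_sum //; exact: dS.
rewrite (near_eq_derive w Eh).
have dh j : differentiable (h j) p /\ 'D_w (h j) p =
    'D_w Y p 0 j *: 'D_(delta_mx 0 j) S p + Y p 0 j *: 'D_w ('D_(delta_mx 0 j) S) p.
  have [d1 <-] := derive_coord j w (dY p Dp).
  by have [dD _] := dDS (delta_mx 0 j); exact: derive_scale (dD p Dp).
rewrite derive_sum; last by move=> j; apply: diff_derivable; have [] := dh j.
by apply: eq_bigr => j _; have [_ ->] := dh j.
Qed.

Lemma derive_field D S Y p w : open D -> D p -> Ck 2 D S -> Ck 1 D Y ->
  'D_w (fun q => 'D_(Y q) S q) p = 'D_('D_w Y p) S p + 'D_w ('D_(Y p) S) p.
Proof.
move=> oD Dp CS CY; rewrite (derive_field_sum _ oD Dp CS CY) big_split /=; congr (_ + _).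
  by rewrite -derive_row_sum //; have [dS _] := CS; exact: dS.
(* The second term is the same expansion for the constant field Y p, whose coefficients have
   derivative 0. *)
rewrite -[RHS]/('D_w (fun q => 'D_((fun=> Y p) q) S q) p).
rewrite (derive_field_sum _ oD Dp CS (Ck_cst 1 D (Y p))).
by apply: eq_bigr => j _; rewrite derive_cst mxE scale0r add0r.
Qed.

End DerivativeAlongFields.

Section CovariantDerivative.
Variables (R : realType) (m n : nat) (c : R) (A : cliff R m -> set 'rV[R]_m).
Hypotheses (cc : c * c = 1)
  (AP : forall q x, grass n q -> orth_proj (A q) x = proj c q x).
Implicit Types (X Y : cliff R m -> cliff R m) (s : cliff R m -> 'rV[R]_m).
Implicit Types (p q u v w : cliff R m) (x y z : 'rV[R]_m).
Local Notation Q := (@grass R m n).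

(** The common form of [nablaT], with A the plane, and [nablaN], with A its complement. *)
Definition cov_derive X s q := orth_proj (A q) (dalong Q s q (X q)).

Lemma cov_deriveE X s S p : grass n p -> tangent n p (X p) ->
  local_extension Q s p S -> cov_derive X s p = proj c p ('D_(X p) S p).
Proof. by move=> gp tX ES; rewrite /cov_derive (AP _ gp) (dalongE gp tX ES). Qed.

(** The formula is defined off the Grassmannian as well, so a covariant derivative can itself be
    differentiated. *)
Lemma cov_derive_ext X Xe s S p : vector_field n X ->
  local_extension Q X p Xe -> local_extension Q s p S ->
  local_extension Q (cov_derive X s) p (fun q => proj c q ('D_(Xe q) S q)).
Proof.
move=> [_ tX] [D [oD Dp CX EX]] [D' [oD' Dp' CS ES]].
have oI : open (D `&` D') by exact: openI.
exists (D `&` D'); split=> // [k|q [Dq Dq'] gq].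
  apply: (Ck_proj c oI); apply: (Ck_derive_field oI) => j.
    by apply: Ck_sub (CS j); exact: subIsetr.
  by apply: Ck_sub (CX j); exact: subIsetl.
rewrite (cov_deriveE gq (tX q gq) (S := S)); first by rewrite (EX q Dq gq).
by exists D'.
Qed.

Lemma dproj_adj p u x : grass n p -> tangent n p u ->
  dproj c p u x = - c *: adj (generator n u p) (rho p x).
Proof.
move=> gp /(tangentP gp) tu; have [pU _] := generator_mixed gp tu.
rewrite /dproj -{1 2}(generatorK u gp) (bracket_rho _ gp pU) linearZ /= scalerA.
by congr (_ *: _); field.
Qed.

Lemma rho_fixed p x : grass n p -> proj c p x = x -> rho p x = c *: x.
Proof.
move=> gp px; have : 2 *: proj c p x - x = x.
  by rewrite px; apply/rowP => i; rewrite !mxE; ring.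
rewrite /proj scalerA mulfV ?pnatr_eq0 // scale1r addrC addKr => /(congr1 ( *:%R c)).
by rewrite scalerA cc scale1r.
Qed.

Lemma proj_adj p U x : grass n p -> mixed_bivector p U ->
  proj c p (adj U x) = adj U (proj (- c) p x).
Proof.
move=> gp mU; rewrite /proj (rho_adj _ gp mU) (linearZZ (adj U)) (linearD (adj U)).
by rewrite (linearZZ (adj U)) /= scalerN scaleNr.
Qed.

Lemma dproj_linear p u : linear (dproj c p u).
Proof.
move=> k x y; rewrite /dproj (linearP (@vec R m)) !(mulrDl, mulrDr) !(cliffZl, cliffZr).
rewrite addrACA -scalerDr (linearP (@unvec R m)).
by apply/rowP => i; rewrite !mxE; ring.
Qed.

Lemma dproj_fixed p u x : grass n p -> tangent n p u -> proj c p x = x ->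
  dproj c p u x = - adj (generator n u p) x.
Proof.
move=> gp tu px; rewrite (dproj_adj _ gp tu) (rho_fixed gp px) (linearZZ (adj _)) /=.
by rewrite scalerA mulNr cc scaleN1r.
Qed.

(** The derivative of a projection is off-diagonal: on the image it is -[adj], which sends that
    subspace to the other one. *)
Lemma proj_dproj_proj p u x : grass n p -> tangent n p u ->
  proj c p (dproj c p u (proj c p x)) = 0.
Proof.
move=> gp tu; have mU := generator_mixed gp ((tangentP gp _).1 tu).
rewrite (dproj_fixed gp tu (proj_idem _ cc gp)) (linearN (proj c p)) /= (proj_adj _ gp mU).
by rewrite projN (proj_idem _ cc gp) subrr linear0 oppr0.
Qed.

Lemma proj_adj_adj p U V x : grass n p -> mixed_bivector p U -> mixed_bivector p V ->
  proj c p x = x -> proj c p (adj U (adj V x)) = adj U (adj V x).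
Proof.
move=> gp mU mV px; rewrite (proj_adj _ gp mU) projN (proj_adj _ gp mV) projN px subrr.
by rewrite (linear0 (adj V)) subr0.
Qed.

Lemma dproj_dproj p u v x : grass n p -> tangent n p u -> tangent n p v ->
  dproj c p u (dproj c p v x) = - adj (generator n u p) (adj (generator n v p) x).
Proof.
move=> gp tu tv; have mV := generator_mixed gp ((tangentP gp _).1 tv).
rewrite (dproj_adj _ gp tu) (dproj_adj _ gp tv) (linearZZ (rho p)) /= (rho_adj _ gp mV).
rewrite (rhoK gp) (linearZZ (adj _)) (linearN (adj _)) /= scalerA mulrNN cc.
by rewrite scale1r.
Qed.

(** Here b stands for the derivative along v of a section with value x. Its projected part is lost
    by Pi dPi Pi = 0, so only the value x matters. *)
Lemma proj_dproj_section p u v x b :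
  grass n p -> tangent n p u -> tangent n p v -> proj c p x = x ->
  b = dproj c p v x + proj c p b ->
  proj c p (dproj c p u b) = - adj (generator n u p) (adj (generator n v p) x).
Proof.
move=> gp tu tv px bE.
have mU := generator_mixed gp ((tangentP gp _).1 tu).
have mV := generator_mixed gp ((tangentP gp _).1 tv).
have dD k l : dproj c p u (k + l) = dproj c p u k + dproj c p u l.
  by rewrite -[k]scale1r dproj_linear !scale1r.
have PD k l : proj c p (k + l) = proj c p k + proj c p l := linearD (proj c p) k l.
have PN k : proj c p (- k) = - proj c p k := linearN (proj c p) k.
rewrite bE dD PD (proj_dproj_proj _ gp tu) addr0 (dproj_dproj _ gp tu tv) PN.
by rewrite (proj_adj_adj gp mU mV px).
Qed.

(** For the curvature, h is the common second derivative of the section, and x - y its derivative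
    along the Lie bracket. *)
Lemma proj_cancel p (a b x y h : 'rV[R]_m) : grass n p ->
  proj c p (a + proj c p (x + h)) - proj c p (b + proj c p (y + h)) - proj c p (x - y) =
  proj c p a - proj c p b.
Proof.
move=> gp.
have PD k l : proj c p (k + l) = proj c p k + proj c p l := linearD (proj c p) k l.
have PN k : proj c p (- k) = - proj c p k := linearN (proj c p) k.
rewrite (PD a) (PD b) (proj_idem (x + h) cc gp) (proj_idem (y + h) cc gp).
rewrite (PD x h) (PD y h) (PD x (- y)) (PN y).
move: (proj c p a) (proj c p b) (proj c p x) (proj c p y) (proj c p h) => a' b' x' y' h'.
by apply/rowP => i; rewrite !mxE; ring.
Qed.

(** The relation S = Pi S holds only on the Grassmannian, so it may be differentiated in tangent
    directions only. *)
Lemma derive_section s S p u : grass n p -> tangent n p u ->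
  (forall q, grass n q -> proj c q (s q) = s q) -> local_extension Q s p S ->
  'D_u S p = dproj c p u (s p) + proj c p ('D_u S p).
Proof.
move=> gp tu sP [D [oD Dp CS ES]]; have [dS _] := CS 1%N.
have dSp := dS p Dp; have [dP _] := Ck_proj c oD (CS 1%N); have dPp := dP p Dp.
apply/eqP; rewrite -(ES p Dp gp) -(derive_proj _ _ dSp) -subr_eq0.
rewrite -deriveB; [|exact: diff_derivable|exact: diff_derivable].
apply/eqP; apply: (derive_tangent_eq0 gp tu); first exact: differentiableB.
apply: filterS (open_nbhs_nbhs (conj oD Dp)) => q Dq gq.
by rewrite -[LHS]/(S q - proj c q (S q)) (ES q Dq gq) (sP q gq) subrr.
Qed.

Lemma derive_cov_ext X Xe s S p u : local_extension Q X p Xe -> local_extension Q s p S ->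
  'D_u (fun q => proj c q ('D_(Xe q) S q)) p =
  dproj c p u ('D_(Xe p) S p) +
  proj c p ('D_('D_u Xe p) S p + 'D_u ('D_(Xe p) S) p).
Proof.
move=> [D [oD Dp CX _]] [D' [oD' Dp' CS _]].
have oI : open (D `&` D') by exact: openI.
have CXI k : Ck k (D `&` D') Xe by apply: Ck_sub (CX k); exact: subIsetl.
have CSI k : Ck k (D `&` D') S by apply: Ck_sub (CS k); exact: subIsetr.
have [d _] := Ck_derive_field oI CSI CXI 1.
rewrite (derive_proj _ _ (d p (conj Dp Dp'))).
by rewrite (derive_field _ oI (conj Dp Dp') (CSI 2%N) (CXI 1%N)).
Qed.

Lemma cov_derive_curvature X Y s p :
  grass n p -> vector_field n X -> vector_field n Y -> smooth_on Q s ->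
  (forall q, grass n q -> proj c q (s q) = s q) ->
  let U := generator n (X p) p in let V := generator n (Y p) p in
  cov_derive X (cov_derive Y s) p - cov_derive Y (cov_derive X s) p
    - cov_derive (lie_bracket n X Y) s p = adj V (adj U (s p)) - adj U (adj V (s p)).
Proof.
move=> gp vX vY ss sP U V.
have [tX tY] : tangent n p (X p) /\ tangent n p (Y p).
  by split; [apply: vX.2|apply: vY.2].
have [mU mV] : mixed_bivector p U /\ mixed_bivector p V.
  by split; apply: (generator_mixed gp); apply/(tangentP gp).
have [Xe EX] := vX.1 p gp; have [Ye EY] := vY.1 p gp; have [S ES] := ss p gp.
have EXs := cov_derive_ext vX EX ES; have EYs := cov_derive_ext vY EY ES.
have L : lie_bracket n X Y p = 'D_(X p) Ye p - 'D_(Y p) Xe p.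
  by rewrite /lie_bracket (dalongE gp tX EY) (dalongE gp tY EX).
have tL : tangent n p (lie_bracket n X Y p).
  by rewrite L; exact: lie_bracket_tangent gp vX vY EX EY.
have [Xep Yep] : Xe p = X p /\ Ye p = Y p.
  by case: EX EY => [D [_ Dp _ E]] [D' [_ Dp' _ E']]; rewrite E // E'.
have [D [oD Dp CS _]] := ES; have [dS _] := CS 1%N; have dSp := dS p Dp.
have EXY := derive_cov_ext (X p) EY ES; have EYX := derive_cov_ext (Y p) EX ES.
(* The order of derivatives is exchanged in one of the two expansions, so that both contain the same
   second derivative, the h of [proj_cancel]. *)
rewrite Yep (schwarz (X p) (Y p) oD Dp (CS 2%N)) in EXY; rewrite Xep in EYX.
have EL : 'D_(lie_bracket n X Y p) S p = 'D_('D_(X p) Ye p) S p - 'D_('D_(Y p) Xe p) S p.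
  apply: etrans (congr1 (fun w => 'D_w S p) L) _; exact: deriveB_dir.
have {}EXY := etrans (cov_deriveE gp tX EYs) (congr1 (proj c p) EXY).
have {}EYX := etrans (cov_deriveE gp tY EXs) (congr1 (proj c p) EYX).
have {}EL := etrans (cov_deriveE gp tL ES) (congr1 (proj c p) EL).
apply: etrans (congr2 +%R (congr2 +%R EXY (congr1 -%R EYX)) (congr1 -%R EL)) _.
have sX := derive_section gp tX sP ES; have sY := derive_section gp tY sP ES.
apply: etrans (proj_cancel _ _ _ _ _ gp) _.
rewrite (proj_dproj_section gp tX tY (sP p gp) sY) (proj_dproj_section gp tY tX (sP p gp) sX).
by rewrite opprK addrC.
Qed.
End CovariantDerivative.

(** * Existence of extensions and the curvature as a Clifford commutator *)

Section Extensions.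
Variables (R : realType) (m n : nat).
Implicit Types (p q u v w U : cliff R m) (x y z : 'rV[R]_m).
Local Notation Q := (@grass R m n).

Lemma smooth_local_extension (W : normedModType R) (f : cliff R m -> W) :
  (forall k, Ck k setT f) -> smooth_on Q f.
Proof. by move=> Cf p gp; exists f, setT; split=> //; exact: openT. Qed.

(** U generates rotations of R^m, which preserve the Grassmannian. Algebraically, [U, .] is a
    derivation, applied here to q q = const and to q x q. *)
Lemma rotation_field U : (forall x, is_vec (bracket (vec x) U)) ->
  vector_field n (bracket U).
Proof.
move=> Uv; split=> [|q gq].
  apply: smooth_local_extension => k.
  apply: (Ck_linear (L := bracket U) openT _ (Ck_id k setT)).
  exact: (@linear_rV_continuous R _ _ (bracket U)).
apply/(tangentP gq); have qq := grass_sq gq; split.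
  have qqU : q * (q * U) = square_sign R n *: U by rewrite mulrA qq cliffZl mul1r.
  have Uqq : U * q * q = square_sign R n *: U by rewrite -mulrA qq cliffZr mulr1.
  rewrite bracketE cliffZl cliffZr -scalerDr mulrBl mulrBr qqU Uqq mulrA.
  by rewrite addrA subrK subrr scaler0.
move=> x.
have -> : bracket U q * vec x * q + q * vec x * bracket U q =
    - bracket (vec (rho q x)) U + q * bracket (vec x) U * q.
  rewrite (vec_rho _ gq) !bracketE !(cliffZl, cliffZr) !(mulrBl, mulrBr) !mulrA.
  cliff_field.
have -> : q * bracket (vec x) U * q = vec (rho q (adj U x)).
  by rewrite (vec_rho _ gq) /adj Uv.
have -> : bracket (vec (rho q x)) U = vec (adj U (rho q x)) by rewrite /adj Uv.
by rewrite -linearN -linearD; exact: is_vec_vec.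
Qed.

Lemma rotation_field_generator p u : grass n p -> tangent n p u ->
  bracket (generator n u p) p = u.
Proof.
move=> gp tu; have [pU _] := generator_mixed gp ((tangentP gp _).1 tu).
by rewrite bracketE pU (generatorK u gp); cliff_field.
Qed.

Lemma Ck_pair (V : normedModType R) k (D : set V) (f g : V -> 'rV[R]_m) : open D ->
  Ck k D f -> Ck k D g -> Ck k D (fun y : V => (f y, g y)).
Proof.
move=> oD Cf Cg.
have l1 : linear (fun x : 'rV[R]_m => (x, 0 : 'rV[R]_m)).
  by move=> a x y; congr pair; rewrite /= scaler0 addr0.
have l2 : linear (fun x : 'rV[R]_m => (0 : 'rV[R]_m, x)).
  by move=> a x y; congr pair; rewrite /= scaler0 addr0.
pose M1 := GRing.isLinear.Build R 'rV[R]_m ('rV[R]_m * 'rV[R]_m)%type *:%R _ l1.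
pose M2 := GRing.isLinear.Build R 'rV[R]_m ('rV[R]_m * 'rV[R]_m)%type *:%R _ l2.
pose L1 : {linear 'rV[R]_m -> ('rV[R]_m * 'rV[R]_m)%type} := HB.pack (fun x : 'rV[R]_m => (x, 0 : 'rV[R]_m)) M1.
pose L2 : {linear 'rV[R]_m -> ('rV[R]_m * 'rV[R]_m)%type} := HB.pack (fun x : 'rV[R]_m => (0 : 'rV[R]_m, x)) M2.
have C1 : Ck k D (fun y : V => L1 (f y)) := Ck_linear oD (@linear_rV_continuous R _ _ L1) Cf.
have C2 : Ck k D (fun y : V => L2 (g y)) := Ck_linear oD (@linear_rV_continuous R _ _ L2) Cg.
apply: Ck_ext (CkD oD C1 C2) => // q _.
by congr pair; rewrite /= ?addr0 ?add0r.
Qed.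

Lemma smooth_on_fst (s : cliff R m -> 'rV[R]_m * 'rV[R]_m) :
  smooth_on Q s -> smooth_on Q (fun q => (s q).1).
Proof.
move=> ss p gp; have [S [D [oD Dp CS ES]]] := ss p gp.
exists (fun q => (S q).1), D; split=> // [k|q Dq gq]; last by rewrite ES.
have l : linear (fun x : 'rV[R]_m * 'rV[R]_m => x.1) by [].
pose M := GRing.isLinear.Build R ('rV[R]_m * 'rV[R]_m)%type 'rV[R]_m *:%R _ l.
pose L : {linear ('rV[R]_m * 'rV[R]_m)%type -> 'rV[R]_m} := HB.pack (fun x : 'rV[R]_m * 'rV[R]_m => x.1) M.
have cL : continuous L by move=> x; exact: cvg_fst.
exact: (Ck_linear oD cL (CS k)).
Qed.

Lemma smooth_on_snd (s : cliff R m -> 'rV[R]_m * 'rV[R]_m) :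
  smooth_on Q s -> smooth_on Q (fun q => (s q).2).
Proof.
move=> ss p gp; have [S [D [oD Dp CS ES]]] := ss p gp.
exists (fun q => (S q).2), D; split=> // [k|q Dq gq]; last by rewrite ES.
have l : linear (fun x : 'rV[R]_m * 'rV[R]_m => x.2) by [].
pose M := GRing.isLinear.Build R ('rV[R]_m * 'rV[R]_m)%type 'rV[R]_m *:%R _ l.
pose L : {linear ('rV[R]_m * 'rV[R]_m)%type -> 'rV[R]_m} := HB.pack (fun x : 'rV[R]_m * 'rV[R]_m => x.2) M.
have cL : continuous L by move=> x; exact: cvg_snd.
exact: (Ck_linear oD cL (CS k)).
Qed.

Lemma plane_sign_sqN : - plane_sign R n * - plane_sign R n = 1.
Proof. by rewrite mulrNN plane_sign_sq. Qed.

Lemma taut_fibre_proj p (xi : 'rV[R]_m * 'rV[R]_m) : grass n p ->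
  taut_fibre n p xi <->
  proj (plane_sign R n) p xi.1 = xi.1 /\ proj (- plane_sign R n) p xi.2 = xi.2.
Proof.
move=> gp; split=> -[h1 h2]; split.
- exact/(plane_proj _ gp).
- exact/(orth_plane_proj _ gp).
- exact/(plane_proj _ gp).
- exact/(orth_plane_proj _ gp).
Qed.

Lemma taut_section_through p (xi : 'rV[R]_m * 'rV[R]_m) : grass n p -> taut_fibre n p xi ->
  exists2 s, taut_section n s & s p = xi.
Proof.
move=> gp /(taut_fibre_proj _ gp)[h1 h2].
exists (fun q => (proj (plane_sign R n) q xi.1, proj (- plane_sign R n) q xi.2)).
  split=> [|q gq].
    apply: smooth_local_extension => k.
    by apply: (Ck_pair openT); apply: (Ck_proj _ openT); exact: Ck_cst.
  apply/(taut_fibre_proj _ gq); split; apply: proj_idem gq.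
    exact: plane_sign_sq.
  exact: plane_sign_sqN.
by rewrite h1 h2; case: (xi).
Qed.

Definition curv_vec u v p x :=
  adj (generator n v p) (adj (generator n u p) x)
  - adj (generator n u p) (adj (generator n v p) x).

Lemma curvature_opE X Y (s : cliff R m -> 'rV[R]_m * 'rV[R]_m) p :
  grass n p -> vector_field n X -> vector_field n Y -> taut_section n s ->
  curvature_op n X Y s p =
  (curv_vec (X p) (Y p) p (s p).1, curv_vec (X p) (Y p) p (s p).2).
Proof.
move=> gp vX vY [ss sf]; congr pair.
  apply: (cov_derive_curvature (A := plane n) (plane_sign_sq R n) _ gp vX vY).
  - by move=> q x gq; exact: orth_proj_plane.
  - exact: smooth_on_fst.
  - by move=> q gq; have [] := (taut_fibre_proj _ gq).1 (sf q gq).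
apply: (cov_derive_curvature (A := fun q => orth (plane n q)) plane_sign_sqN _ gp vX vY).
- by move=> q x gq; exact: orth_proj_orth.
- exact: smooth_on_snd.
- by move=> q gq; have [] := (taut_fibre_proj _ gq).1 (sf q gq).
Qed.

Lemma eps_signE : eps_sign R n = - square_sign R n.
Proof. by rewrite /eps_sign exprD expr1 mulrN1. Qed.

Lemma bracket_tangent p u v : grass n p -> tangent n p u -> tangent n p v ->
  bracket (generator n u p) (generator n v p) = eps_sign R n *: bracket u v.
Proof.
move=> gp tu tv; have [pU _] := generator_mixed gp ((tangentP gp _).1 tu).
have [pV _] := generator_mixed gp ((tangentP gp _).1 tv).
have uE := generatorK u gp; have vE := generatorK v gp.
set U := generator n u p in pU uE *; set V := generator n v p in pV vE *.
(* Moving p past b gives -1 and p p gives [square_sign]: this is the origin of [eps_sign]. *)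
have mulE a b : p * b = - (b * p) -> (a * p) * (b * p) = - square_sign R n *: (a * b).
  by move=> pb; rewrite -!mulrA (mulrA p b) pb mulNr mulrN -mulrA (grass_sq gp) cliffZr mulr1 cliffZr scaleNr.
rewrite -uE -vE !bracketE (mulE U V pV) (mulE V U pU) -scalerBr !scalerA eps_signE.
by rewrite mulrAC mulrNN square_sign_sq mul1r.
Qed.

Lemma vec_adj_adj p U V x : mixed_bivector p U -> mixed_bivector p V ->
  vec (adj V (adj U x)) = bracket (bracket (vec x) U) V.
Proof. by move=> mU mV; rewrite (vec_adj _ mV) (vec_adj _ mU). Qed.

Lemma vec_curv_vec p u v x : grass n p -> tangent n p u -> tangent n p v ->
  vec (curv_vec u v p x) = eps_sign R n *: bracket (vec x) (bracket u v).
Proof.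
move=> gp tu tv.
have mU := generator_mixed gp ((tangentP gp _).1 tu).
have mV := generator_mixed gp ((tangentP gp _).1 tv).
rewrite -(linearZZ (bracket (vec x))) /= -(bracket_tangent gp tu tv) jacobi /curv_vec.
move: (generator n u p) (generator n v p) mU mV => U V mU mV.
apply: etrans (linearB (@vec R m) _ _) _.
exact: (congr2 (fun a b => a - b) (vec_adj_adj x mU mV) (vec_adj_adj x mV mU)).
Qed.

Lemma curv_vec_fixed k p u v x : grass n p -> tangent n p u -> tangent n p v ->
  proj k p x = x -> proj k p (curv_vec u v p x) = curv_vec u v p x.
Proof.
move=> gp tu tv px.
have mU := generator_mixed gp ((tangentP gp _).1 tu).
have mV := generator_mixed gp ((tangentP gp _).1 tv).
rewrite /curv_vec; move: (generator n u p) (generator n v p) mU mV => U V mU mV.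
rewrite (linearB (proj k p)).
exact: (congr2 (fun a b : 'rV[R]_m => a - b) (proj_adj_adj gp mV mU px) (proj_adj_adj gp mU mV px)).
Qed.

Lemma is_curvature_curv_vec p u v xi : grass n p -> tangent n p u -> tangent n p v ->
  taut_fibre n p xi -> is_curvature n p u v xi (curv_vec u v p xi.1, curv_vec u v p xi.2).
Proof.
move=> gp tu tv xip; split.
  have [s ts sp] := taut_section_through gp xip.
  have [_ Uv] := generator_mixed gp ((tangentP gp _).1 tu).
  have [_ Vv] := generator_mixed gp ((tangentP gp _).1 tv).
  exists (bracket (generator n u p)), (bracket (generator n v p)), s; split; split=> //.
  - exact: rotation_field.
  - exact: rotation_field.
  - exact: rotation_field_generator.
  - exact: rotation_field_generator.
move=> X Y s [[vX vY ts] [Xp Yp sp]].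
by rewrite (curvature_opE gp vX vY ts) Xp Yp sp.
Qed.

Lemma curvatureE p u v xi : grass n p -> tangent n p u -> tangent n p v ->
  taut_fibre n p xi -> curvature n p u v xi = (curv_vec u v p xi.1, curv_vec u v p xi.2).
Proof.
move=> gp tu tv xip; have isc := is_curvature_curv_vec gp tu tv xip.
rewrite /curvature; set S := (X in get X).
have [_ Sg] : S (get S) by apply: (@getI _ _ _ isc).
(* Uniqueness comes from existence: a single extension forces both candidates to equal its curvature
   at p. *)
have [[X [Y [s e]]] r] := isc.
by rewrite -(Sg X Y s e) (r X Y s e).
Qed.

End Extensions.

(** * Bivectors of the plane and its complement as skew operators *)

Section Bivectors.
Variables (R : realType) (m n : nat).
Implicit Types (p u v eta : cliff R m) (x y z : 'rV[R]_m) (xi : 'rV[R]_m * 'rV[R]_m).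

Lemma Lambda2_sum (T : finType) (A : set 'rV[R]_m) (x y : T -> 'rV[R]_m) :
  (forall t, A (x t)) -> (forall t, A (y t)) ->
  Lambda2 A (\sum_t wedge (vec (x t)) (vec (y t))).
Proof.
move=> Ax Ay; exists #|T|, (fun i => x (enum_val i)), (fun i => y (enum_val i)).
by split=> //; rewrite (reindex (@enum_val T T)) //=; exact: onW_bij _ (enum_val_bij T).
Qed.

Lemma mul_vec_wedge x y : vec x * vec y = wedge (vec x) (vec y) - dot x y *: 1 :> cliff R m.
Proof.
have := vec_comm x y; rewrite wedge_vec_vec bracketE => E.
rewrite [vec y * _](_ : _ = - (vec x * vec y) + (- (2 * dot x y)) *: 1); last first.
  by rewrite dotC -vec_comm.
by cliff_field.
Qed.

Lemma wedge_vecZl (k : R) x b : wedge (vec (k *: x)) b = k *: wedge (vec x) b.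
Proof. by rewrite (linearZZ (@vec R m)) -[LHS]/(wedger b _) linearZ. Qed.

(** With x, z in the plane and y, w normal, the mixed terms cancel: one product lies in the plane
    and one in the complement. *)
Lemma bracket_mixed x y z w : dot x y = 0 -> dot y z = 0 -> dot z w = 0 -> dot x w = 0 ->
  bracket (vec x * vec y) (vec z * vec w) =
  dot y w *: (vec x * vec z) - dot x z *: (vec w * vec y) :> cliff R m.
Proof.
move=> xy yz zw xw; rewrite bracketE.
have yz' := vec_anticommutes yz; have wx' := vec_anticommutes (etrans (dotC w x) xw).
have -> : vec x * vec y * (vec z * vec w) = - (vec x * vec z * (vec y * vec w)) :> cliff R m.
  by rewrite -mulrA (mulrA (vec y)) yz' !(mulNr, mulrN) !mulrA.
have -> : vec z * vec w * (vec x * vec y) = - (vec z * vec x * (vec w * vec y)) :> cliff R m.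
  by rewrite -mulrA (mulrA (vec w)) wx' !(mulNr, mulrN) !mulrA.
rewrite (vec_comm y w) (vec_comm z x) (dotC z x).
rewrite !(mulrDl, mulrDr, mulNr, mulrN, cliffZl, cliffZr, mul1r, mulr1) !mulrA.
by cliff_field.
Qed.

Lemma bracket_tangent_Lambda2 p u v : grass n p -> tangent n p u -> tangent n p v ->
  taut_bivector n p (eps_sign R n *: bracket u v).
Proof.
move=> gp tu tv; rewrite -(bracket_tangent gp tu tv); case: (gp) => e pe.
have [A [eA _ ->]] := tangent_frame pe ((tangentP gp _).1 tu).
have [B [eB _ ->]] := tangent_frame pe ((tangentP gp _).1 tv).
have inP i : plane n p (row i e) by exists e => //; exact: row_sub.
have inN C i : e *m C *m e^T = 0 -> orth (plane n p) (row i e *m C).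
  by move=> eC; apply/(orth_plane_frame _ pe); rewrite -!row_mul eC row0.
have nA i j : dot (row j e) (row i e *m A) = 0.
  by rewrite dotC dot_row -!row_mul eA !mxE.
have nB i j : dot (row j e) (row i e *m B) = 0.
  by rewrite dotC dot_row -!row_mul eB !mxE.
pose a i := row i e *m A; pose b i := row i e *m B.
(* By [bracket_mixed], the bracket of e_i a_i with e_j b_j is <a_i, b_j> e_i e_j - delta_ij b_j a_i;
   the two witnesses collect these parts. *)
exists (\sum_(t : 'I_n * 'I_n) wedge (vec (dot (a t.1) (b t.2) *: row t.1 e)) (vec (row t.2 e))).
exists (\sum_i wedge (vec (- b i)) (vec (a i))).
have ZP k x : plane n p x -> plane n p (k *: x).
  by move/(plane_proj _ gp) => px; apply/(plane_proj _ gp); rewrite linearZ /= px.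
split.
- by apply: Lambda2_sum => t //; exact: ZP.
- apply: Lambda2_sum => i; last exact: inN.
  move=> y Py; rewrite dotC -scaleN1r dotZr dotC mulN1r.
  by rewrite (inN B i eB y Py) oppr0.
rewrite /frame_bivector linear_sum /=.
transitivity (\sum_j \sum_i (wedge (vec (dot (a i) (b j) *: row i e)) (vec (row j e))
    + (i == j)%:R *: wedge (vec (- b j)) (vec (a i))) : cliff R m).
  apply: eq_bigr => j _; rewrite -[bracket _ _]/(bracketr _ _) linear_sum; apply: eq_bigr => i _.
  rewrite /= /bracketr bracket_mixed ?nA ?nB //; last by rewrite dotC nA.
  (* Passing from Clifford to exterior products creates scalars only for i = j, and there the two
     cancel. *)
  rewrite (mul_vec_wedge (row i e)) (mul_vec_wedge (row j e *m B)) (frame_dot pe).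
  rewrite wedge_vecZl -[- b j]scaleN1r wedge_vecZl -/(a i) -/(b j).
  case: (eqVneq i j) => [->|_] /=; last by cliff_linear.
  by rewrite (dotC (b j)); cliff_linear.
rewrite exchange_big (eq_bigr _ (fun i _ => big_split _ _ _ _ _)) big_split /=; congr (_ + _).
  by rewrite pair_big.
apply: eq_bigr => i _; rewrite (bigD1 i) //= eqxx scale1r big1 ?addr0 // => j ji.
by rewrite eq_sym (negbTE ji) scale0r.
Qed.

Definition wedge_action (k : nat) (x y : 'I_k -> 'rV[R]_m) z : 'rV[R]_m :=
  \sum_i (dot z (y i) *: x i - dot z (x i) *: y i).

Lemma bracket_wedge z x y :
  bracket (vec z) (wedge (vec x) (vec y)) = vec (dot z y *: x - dot z x *: y).
Proof.
rewrite wedge_vec_vec [bracket (vec x) _]bracketE (linearZZ (bracket (vec z))) (linearB (bracket (vec z))) /=.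
rewrite !bracket_vec_mul !(linearB (@vec R m)) !(linearZZ (@vec R m)).
by cliff_field.
Qed.

Lemma bracket_wedge_sum k (x y : 'I_k -> 'rV[R]_m) z :
  bracket (vec z) (\sum_i wedge (vec (x i)) (vec (y i))) = vec (wedge_action x y z).
Proof.
rewrite linear_sum /wedge_action linear_sum /=; apply: eq_bigr => i _.
exact: bracket_wedge.
Qed.

Lemma wedge_action_skew k (x y : 'I_k -> 'rV[R]_m) z t :
  dot (wedge_action x y z) t = - dot z (wedge_action x y t).
Proof.
have dot0 w : dot 0 w = 0 :> R by rewrite -(scale0r w) dotZl mul0r.
rewrite (dotC z) /wedge_action.
elim/big_ind2: _ => [|a b c d ab cd|i _].
- by rewrite !dot0 oppr0.
- by rewrite !dotDl ab cd opprD.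
by rewrite !dotBl !dotZl !(dotC _ t) !(dotC _ z); ring.
Qed.

Lemma wedge_action_in k q (x y : 'I_k -> 'rV[R]_m) (c : R) z :
  (forall i, proj c q (x i) = x i /\ proj c q (y i) = y i) ->
  proj c q (wedge_action x y z) = wedge_action x y z.
Proof.
move=> xy; rewrite /wedge_action linear_sum; apply: eq_bigr => i _.
by rewrite linearB /= !(linearZZ (proj c q)) /= (xy i).1 (xy i).2.
Qed.

Lemma dot_blade (a : cliff R m) I : dot a (blade R I) = coef a I.
Proof. by rewrite dotE trmx_delta -colE mxE. Qed.

(** [skew_operator] measures inside the Clifford algebra; [vec] being isometric, skewness can be
    checked on R^m. *)
Lemma dot_vec x y : dot (vec x) (vec y) = dot x y.
Proof.
rewrite [vec y]/vec (dotE (vec x)) raddf_sum mulmx_sumr summxE; apply: eq_bigr => i _.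
rewrite -(dotE (vec x)) dotZr dot_blade mulrC; congr (_ * _).
by have := congr1 (fun v : 'rV[R]_m => v 0 i) (vecK x); rewrite mxE.
Qed.

Lemma bivector_skew p eta : grass n p -> taut_bivector n p eta ->
  skew_operator n p (bivector_op eta).
Proof.
move=> gp [eta1 [eta2 [[k [x [y [xyP ->]]]] [k' [x' [y' [xyN ->]]]] ->]]].
pose act z := wedge_action x y z + wedge_action x' y' z.
have opE xi : bivector_op (\sum_i wedge (vec (x i)) (vec (y i)) +
    \sum_i wedge (vec (x' i)) (vec (y' i))) (taut_vec xi) = vec (act (xi.1 + xi.2)).
  rewrite /bivector_op /taut_vec (linearD (bracket (vec (xi.1 + xi.2)))) /=.
  by rewrite !bracket_wedge_sum (linearD (@vec R m)).
have actS z t : dot (act z) t = - dot z (act t).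
  by rewrite dotDl !wedge_action_skew /act dotDr opprD.
split=> [xi _|xi zeta _ _].
  (* Each summand may be applied to the whole vector: its values are combinations of the x_i and
     y_i, hence stay in the plane or in the complement whatever the argument. *)
  exists (wedge_action x y (xi.1 + xi.2), wedge_action x' y' (xi.1 + xi.2)); last exact: opE.
  apply/(taut_fibre_proj _ gp); split; apply: wedge_action_in => i.
    by have [? ?] := xyP i; split; apply/(plane_proj _ gp).
  by have [? ?] := xyN i; split; apply/(orth_plane_proj _ gp).
by rewrite !opE /taut_vec !dot_vec; exact: actS.
Qed.

End Bivectors.

Theorem theorem4 (R : realType) (m n : nat) (p u v : cliff R m)
    (hp : grass n p) (hu : tangent n p u) (hv : tangent n p v) :
  (forall xi : 'rV[R]_m * 'rV[R]_m, taut_fibre n p xi ->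
     [/\ is_curvature n p u v xi (curvature n p u v xi),
         taut_fibre n p (curvature n p u v xi)
       & taut_vec (curvature n p u v xi)
         = eps_sign R n *: bracket (taut_vec xi) (bracket u v)])
  /\
  [/\ taut_bivector n p (eps_sign R n *: bracket u v),
      forall eta : cliff R m, taut_bivector n p eta ->
        skew_operator n p (bivector_op eta)
    & forall xi : 'rV[R]_m * 'rV[R]_m, taut_fibre n p xi ->
        taut_vec (curvature n p u v xi)
        = bivector_op (eps_sign R n *: bracket u v) (taut_vec xi)].
Proof.
have curvE xi : taut_fibre n p xi -> taut_vec (curvature n p u v xi) =
    eps_sign R n *: bracket (taut_vec xi) (bracket u v).
  move=> xip; rewrite (curvatureE hp hu hv xip) /taut_vec.
  apply: etrans (linearD (@vec R m) _ _) _.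
  apply: etrans (congr2 +%R (vec_curv_vec xi.1 hp hu hv) (vec_curv_vec xi.2 hp hu hv)) _.
  apply: etrans (esym (scalerDr _ _ _)) _; congr (_ *: _).
  by rewrite (linearD (@vec R m)) bracketDl.
split=> [xi xip|].
  split; last exact: curvE.
    by rewrite (curvatureE hp hu hv xip); exact: is_curvature_curv_vec.
  rewrite (curvatureE hp hu hv xip); apply/(taut_fibre_proj _ hp).
  have [h1 h2] := (taut_fibre_proj _ hp).1 xip.
  by split; exact: curv_vec_fixed.
split=> [|eta|xi xip]; [exact: bracket_tangent_Lambda2|exact: bivector_skew|].
rewrite (curvE _ xip).
exact: (esym (linearZZ (bracket (taut_vec xi)) (eps_sign R n) (bracket u v))).
Qed.
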